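(* Let $(x_i)_{i\ge1}$ be i.i.d. $\mathcal N(0,1)$ random variables and $(a_i)_{i\ge1}$ a non-decreasing sequence of positive reals with $\sum_i a_i^{-2}<\infty$. Let $z=\sum_{i=1}^\infty x_i^2/a_i^2$ and $F(s)=\mathbb{P}(z<s)$. Then $F\in\Gamma_0$ with auxiliary function \[ \rho(s)=\frac{1}{\mu^{-1}(s)}\quad (s>0 \text{ small}),\qquad \rho(0)=0, \] where $\mu(\theta)=\sum_{i=1}^\infty \frac{1}{a_i^2+2\theta}$ and $\mu^{-1}$ denotes the inverse function of $\mu$ (which is strictly decreasing from $(0,\infty)$ onto $(0,\mu(0))$).
   Context: Definition of $\Gamma_0$: $\Gamma_0$ is the class of functions $F:\mathbb{R}\to\mathbb{R}^+$ which vanish on $(-\infty,0]$ (in particular $F(0)=0$), are non-decreasing and right-continuous, and for which there exists a continuous non-decreasing function $\rho:\mathcal V^+\to\mathbb{R}^+$ defined on a right-neighbourhood $\mathcal V^+$ of $0$, with $\rho(0)=0$ (called an auxiliary function of $F$), such that for every $x\in\mathbb{R}$, \[ \lim_{s\downarrow 0}\frac{F(s+x\rho(s))}{F(s)}=e^{x}. \] *)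

(* Defs.v *)
From HB Require Import structures.
From mathcomp Require Import all_boot all_order all_algebra.
From mathcomp Require Import all_classical all_reals all_analysis.
Set Implicit Arguments. Unset Strict Implicit. Unset Printing Implicit Defensive.
Import Order.TTheory GRing.Theory Num.Def Num.Theory.
Import numFieldNormedType.Exports.
Local Open Scope classical_set_scope.
Local Open Scope ring_scope.

Definition aux_function {R : realType} (F rho : R -> R) : Prop :=
  exists eps : R, 0 < eps /\
    {within `[0, eps[, continuous rho} /\
    {in `[0, eps[ &, {homo rho : u v / u <= v}} /\
    (forall s, s \in `[0, eps[ -> 0 <= rho s) /\
    rho 0 = 0 /\
    forall x : R, (fun s => F (s + x * rho s) / F s) @ 0^'+ --> expR x.

Definition Gamma0 {R : realType} (F : R -> R) : Prop :=
  (forall s, 0 <= F s) /\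
  (forall s, s <= 0 -> F s = 0) /\
  {homo F : u v / u <= v} /\
  (forall s, F @ s^'+ --> F s) /\
  exists rho : R -> R, aux_function F rho.

Definition iid_std_normal {R : realType} {d : measure_display}
  {T : measurableType d} (P : probability T R) (X : nat -> T -> R) : Prop :=
  (forall i, measurable_fun setT (X i)) /\
  (forall i (A : set R), measurable A ->
      P (X i @^-1` A) = normal_prob 0 1 A) /\
  (forall (s : seq nat) (A : nat -> set R), uniq s ->
      (forall i, measurable (A i)) ->
      P (\bigcap_(i in [set` s]) (X i @^-1` A i)) =
      (\prod_(i <- s) P (X i @^-1` A i))%E).

Definition zsum {R : realType} {T : Type} (a : nat -> R) (X : nat -> T -> R)
  (w : T) : \bar R :=
  (\sum_(0 <= i <oo) ((X i w) ^+ 2 / (a i) ^+ 2)%:E)%E.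

Definition cdf_strict {R : realType} {d : measure_display}
  {T : measurableType d} (P : probability T R) (a : nat -> R)
  (X : nat -> T -> R) (s : R) : R :=
  fine (P [set w | (zsum a X w < s%:E)%E]).

Definition mu {R : realType} (a : nat -> R) (theta : R) : R :=
  limn (series (fun i => ((a i) ^+ 2 + 2 * theta)^-1)).

Definition mu_inv {R : realType} (a : nat -> R) (s : R) : R :=
  xget 0 [set theta | 0 < theta /\ mu a theta = s].

Definition rho_aux {R : realType} (a : nat -> R) (s : R) : R :=
  if 0 < s then (mu_inv a s)^-1 else 0.

(* Main.v *)
Require Import Defs.
From HB Require Import structures.
From mathcomp Require Import all_boot all_order all_algebra.
From mathcomp Require Import all_classical all_reals all_analysis.
From mathcomp Require Import measurable_realfun ring lra.
Import Order.TTheory GRing.Theory Num.Def Num.Theory.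
Import numFieldNormedType.Exports.
Local Open Scope classical_set_scope.
Local Open Scope ring_scope.

Local Notation leb := (@lebesgue_measure _).

(* The proof avoids any local limit theorem: it combines log-concavity of F with
   a concentration estimate for exponentially tilted measures.

   Log-concavity.  The partial sums z_n have distribution functions F_n with
   F_(n+1)(s) = E F_n(s - x^2 / a_n^2), and since the integrand is even in x and
   jointly log-concave, a Prekopa argument for symmetric intervals shows that
   every F_n, hence the limit F, is log-concave.

   Concentration.  The Laplace transform of F is theta^-1 times the product of
   the (1 + 2 theta / a_i^2)^(-1/2), so a Chernoff bound shows that more than a
   quarter of the mass of e^(-theta t) F(t) dt lies at distance at most w of
   mu(theta), with w = 4 h V + 3 / h, V = sum_i (a_i^2 + 2 theta)^-2 and any
   0 < h <= theta / 2, while each of the two tails carries at most a quarter.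
   Therefore e^(-theta t) F(t) is neither nondecreasing up to mu(theta) + 3 w nor
   nonincreasing from mu(theta) - 3 w on.

   Conclusion.  As theta^2 V tends to infinity, the windows attached to
   (1 - d) theta, theta and (1 + d) theta separate on the scale 1 / theta. By
   log-concavity the logarithmic derivative of F thus lies between
   (1 - d) theta and (1 + d) theta on the whole interval
   mu(theta) + [-K / theta, K / theta], which is the claim for s = mu(theta). *)

(** * Distribution functions of the partial sums *)

Definition partial_zsum {R : realType} {T : Type} (a : nat -> R)
  (X : nat -> T -> R) (n : nat) (w : T) : R :=
  \sum_(i < n) X i w ^+ 2 / a i ^+ 2.

Definition partial_cdf {R : realType} {d : measure_display}
  {T : measurableType d} (P : probability T R) (a : nat -> R)
  (X : nat -> T -> R) (n : nat) (s : R) : R :=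
  fine (P [set w | partial_zsum a X n w < s]).

(** The hypothesis factors only over preimages of single coordinates. The finite measures [m1] and
    [m2] agree on the pi-system [G] of cylinders in the first [n] coordinates, hence on the
    sigma-algebra it generates, for which the partial sum is measurable. *)
Lemma partial_zsum_indep {R : realType} {d : measure_display}
  {T : measurableType d} (P : probability T R) (a : nat -> R)
  (X : nat -> T -> R) (n : nat) (A B : set R) :
  iid_std_normal P X -> measurable A -> measurable B ->
  P (partial_zsum a X n @^-1` A `&` X n @^-1` B) =
  (P (partial_zsum a X n @^-1` A) * P (X n @^-1` B))%E.
Proof.
move=> [mX [_ indX]] mA mB.
have mXpre i C : measurable C -> measurable (X i @^-1` C).
  by move=> mC; rewrite -[X in measurable X]setTI; exact: mX.
pose cyl (C : nat -> set R) := \bigcap_(i in [set` iota 0 n]) (X i @^-1` C i).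
pose G : set (set T) := [set E | exists2 C, (forall i, measurable (C i)) & E = cyl C].
have Gm : G `<=` measurable.
  move=> _ [C mC ->]; rewrite /cyl; apply: fin_bigcap_measurable => //.
  by move=> i _; exact: mXpre.
have GT : G setT.
  exists (fun=> setT); first by move=> i; exact: measurableT.
  by apply/seteqP; split => // w _ i _.
have GI : setI_closed G.
  move=> _ _ [C mC ->] [D mD ->]; exists (fun i => C i `&` D i).
    by move=> i; exact: measurableI.
  rewrite /cyl -bigcapI; apply: eq_bigcapr => i _; exact: preimage_setI.
have fB : P (X n @^-1` B) \is a fin_num by rewrite fin_num_measure//; exact: mXpre.
pose r : {nonneg R} := NngNum (fine_ge0 (measure_ge0 P (X n @^-1` B))).
pose m1 : {measure set T -> \bar R} := mrestr P (mXpre n B mB).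
pose m2 : {measure set T -> \bar R} := mscale r P.
have m1E E : m1 E = P (E `&` X n @^-1` B) by [].
have m2E E : m2 E = (P (X n @^-1` B) * P E)%E.
  transitivity ((fine (P (X n @^-1` B)))%:E * P E)%E; first by [].
  by rewrite fineK.
have m12 E : <<s G >> E -> m1 E = m2 E.
  apply: (g_sigma_algebra_measure_unique G Gm (fun=> setT)) => //.
  - by apply/seteqP; split => // w _; exists 0%N.
  - move=> _ [C mC ->]; rewrite m1E m2E.
    pose D i := if i == n then B else C i.
    have mD i : measurable (D i) by rewrite /D; case: ifP.
    have DC i : i \in iota 0 n -> D i = C i.
      by rewrite mem_iota add0n /D => /andP[_]; case: eqP => // ->; rewrite ltnn.
    have -> : cyl C `&` X n @^-1` B = \bigcap_(i in [set` n :: iota 0 n]) (X i @^-1` D i).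
      apply/seteqP; split => w.
        move=> [cw Bw] i /=; rewrite inE => /orP[/eqP ->|iin].
          by rewrite /D eqxx.
        by rewrite DC//; exact: cw.
      move=> Dw; split; last first.
        by have := Dw n; rewrite /D eqxx; apply; rewrite /= inE eqxx.
      by move=> i /= iin; rewrite -DC//; apply: Dw; rewrite /= inE iin orbT.
    rewrite indX//; last by rewrite /= iota_uniq andbT mem_iota add0n ltnn andbF.
    rewrite big_cons {1}/D eqxx; congr (_ * _)%E.
    rewrite /cyl indX ?iota_uniq//; apply: eq_big_seq => i iin; by rewrite DC.
  - by move=> _; rewrite m1E setTI ltey_eq fB.
(* Measurability is needed for the sigma-algebra generated by [G], not for the ambient one; [k <= n]
   keeps every coordinate used inside the cylinders. *)
have mS k : (k <= n)%N ->
    measurable_fun setT (partial_zsum a X k : g_sigma_algebraType G -> R).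
  elim: k => [|k IH] kn.
    rewrite /partial_zsum (_ : (fun _ => _) = cst 0); first exact: measurable_cst.
    by apply/funext => w; rewrite big_ord0.
  have -> : partial_zsum a X k.+1 =
      (fun w => partial_zsum a X k w + X k w ^+ 2 * (a k ^+ 2)^-1).
    by apply/funext => w; rewrite /partial_zsum big_ord_recr.
  apply: measurable_funD; first by apply: IH; exact: ltnW.
  apply: measurable_funM; last exact: measurable_cst.
  apply: measurable_funX; move=> _ C mC; rewrite setTI.
  apply: sub_sigma_algebra; exists (fun i => if i == k then C else setT).
    by move=> i; case: ifP.
  apply/seteqP; split => w /=.
    by move=> Cw i _; rewrite /preimage/=; case: eqP => // ->.
  by move=> /(_ k); rewrite /preimage/= eqxx; apply; rewrite /= mem_iota.
have EA : <<s G >> (partial_zsum a X n @^-1` A).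
  by have := mS n (leqnn n) measurableT A mA; rewrite setTI.
by have := m12 _ EA; rewrite m1E m2E => ->; rewrite muleC.
Qed.

Lemma measurable_partial_zsum {R : realType} {d : measure_display}
  {T : measurableType d} (P : probability T R) (a : nat -> R)
  (X : nat -> T -> R) (n : nat) :
  iid_std_normal P X -> measurable_fun setT (partial_zsum a X n).
Proof.
move=> [mX _]; rewrite /partial_zsum; apply: measurable_sum => i.
by apply: measurable_funM => //; apply: measurable_funX.
Qed.

Lemma integral_normal_prob {R : realType} (m s : R) (f : R -> \bar R) :
  (normal_prob m s).-integrable setT f ->
  (\int[normal_prob m s]_x f x = \int[leb]_x (f x * (normal_pdf m s x)%:E))%E.
Proof.
move=> intf; have mf := measurable_int _ intf.
rewrite -(Radon_Nikodym_change_of_variables (normal_prob_dominates m s))//=.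
apply: ae_eq_integral => //.
- apply: emeasurable_funM => //; apply: (measurable_int leb).
  by apply: Radon_Nikodym_integrable; exact: normal_prob_dominates.
- apply: emeasurable_funM => //=; apply/measurable_EFinP.
  exact: measurable_normal_pdf.
- apply: ae_eqe_mul2l => /=.
  rewrite Radon_NikodymE//=; first exact: normal_prob_dominates.
  move=> dom; case: cid => /= h [h1 h2 h3].
  apply: integral_ae_eq => //=.
  + by apply/measurable_EFinP; exact: measurable_normal_pdf.
  + by move=> E _ mE; rewrite -h3.
Qed.

(** By independence the joint law of [X n] and the partial sum is the product of their laws; slicing
    [C] at [X n = x] leaves the event that the partial sum is below [s - x^2 / a_n^2]. *)
Lemma partial_cdf_recursion {R : realType} {d : measure_display}
  {T : measurableType d} (P : probability T R) (a : nat -> R)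
  (X : nat -> T -> R) (n : nat) (s : R) :
  iid_std_normal P X ->
  ((partial_cdf P a X n.+1 s)%:E = \int[leb]_x
    (normal_pdf 0 1 x * partial_cdf P a X n (s - (a n ^+ 2)^-1 * x ^+ 2))%:E)%E.
Proof.
move=> iidX; have [mX [lawX _]] := iidX.
have mS k := measurable_partial_zsum P a X k iidX.
pose mSmix := isMeasurableFun.Build _ _ _ _ _ (mS n).
pose S : {RV P >-> R} := HB.pack (partial_zsum a X n) mSmix.
have mXS : measurable_fun setT
    (fun w => (X n w, partial_zsum a X n w) : measurableTypeR R * R).
  apply: (@measurable_fun_pair _ _ _ T (measurableTypeR R) R).
    exact: mX.
  exact: mS.
have [m' m'E] : exists m' : {measure set (measurableTypeR R * R)%type -> \bar R},
    m' = pushforward P (fun w => (X n w, partial_zsum a X n w)) :> (set _ -> _).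
  by exists (measure_function_pushforward__canonical__measure_function_Measure P mXS).
pose C := [set p : measurableTypeR R * R | p.2 + p.1 ^+ 2 * (a n ^+ 2)^-1 < s].
have mC : measurable C.
  have : measurable_fun setT (fun p : measurableTypeR R * R => p.2 + p.1 ^+ 2 * (a n ^+ 2)^-1 < s).
    apply: measurable_fun_ltr => //; apply: measurable_funD => //.
    by apply: measurable_funM => //; apply: measurable_funX; exact: measurable_fst.
  by move=> /(_ measurableT [set true]); rewrite setTI; exact.
have mlt k t : measurable [set w | partial_zsum a X k w < t].
  have : measurable_fun setT (fun w => partial_zsum a X k w < t).
    exact: measurable_fun_ltr.
  by move=> /(_ measurableT [set true]); rewrite setTI; exact.
have E : ((normal_prob 0 1 \x distribution P S) C = m' C)%E.
  apply: product_measure_unique => // A B mA mB.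
  rewrite m'E /pushforward.
  have -> : (fun w => (X n w, partial_zsum a X n w)) @^-1` (A `*` B) =
     partial_zsum a X n @^-1` B `&` X n @^-1` A.
    by apply/seteqP; split => w /= [].
  by rewrite partial_zsum_indep// muleC lawX.
transitivity (m' C).
  rewrite m'E /pushforward /partial_cdf fineK ?fin_num_measure//.
  congr (P _); apply/seteqP; split => w /=;
  by rewrite /C/= /partial_zsum big_ord_recr.
rewrite -E.
transitivity (\int[normal_prob 0 1]_x (partial_cdf P a X n (s - (a n ^+ 2)^-1 * x ^+ 2))%:E)%E.
  apply: eq_integral => x _.
  rewrite /= /distribution /pushforward /partial_cdf fineK ?fin_num_measure//.
  congr (P _); apply/seteqP; split => w /=;
  by rewrite /xsection/C/= ?inE/= ltrBrDr mulrC.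
have mcdf : measurable_fun setT
    (fun x : R => partial_cdf P a X n (s - (a n ^+ 2)^-1 * x ^+ 2)).
  apply: (@measurableT_comp _ _ _ _ _ _ (partial_cdf P a X n)).
    apply: nondecreasing_measurable => // x y xy; rewrite /partial_cdf.
    rewrite fine_le ?fin_num_measure// le_measure ?inE// => w /= /lt_le_trans; exact.
  by apply: measurable_funB => //; apply: measurable_funM.
rewrite integral_normal_prob; first by apply: eq_integral => x _; rewrite muleC.
apply/integrableP; split; first exact/measurable_EFinP.
apply: (@le_lt_trans _ _ (\int[normal_prob 0 1]_x (cst 1%E x))%E); last first.
  by rewrite integral_cst// mul1e (le_lt_trans (probability_le1 _ measurableT))// ltry.
apply: ge0_le_integral => //.
- by apply/measurable_EFinP; apply: measurableT_comp.
- move=> x _; rewrite /partial_cdf fineK ?fin_num_measure// gee0_abs//.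
  exact: probability_le1.
Qed.

(** * Log-concavity and the Prekopa argument *)

(* This is G (l u + (1 - l) v) >= G u ^ l * G v ^ (1 - l), written with arbitrary
   exponential tilts so that no logarithm of a possibly null value occurs. *)
Definition log_concave {R : realType} (G : R -> R) : Prop :=
  forall al be u v l : R, 0 <= l <= 1 ->
    minr (expR al * G u) (expR be * G v) <=
    expR (l * al + (1 - l) * be) * G (l * u + (1 - l) * v).

(** Convexity of the exponential, from its tangent at the point [m]. *)
Lemma ler_expR_combination {R : realType} (l x y : R) : 0 <= l <= 1 ->
  expR (l * x + (1 - l) * y) <= l * expR x + (1 - l) * expR y.
Proof.
move=> /andP[l0 l1].
set m := l * x + (1 - l) * y.
have hx : expR m * (1 + (x - m)) <= expR x.
  have -> : expR x = expR m * expR (x - m) by rewrite -expRD subrKC.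
  by rewrite ler_wpM2l ?expR_ge0// expR_ge1Dx.
have hy : expR m * (1 + (y - m)) <= expR y.
  have -> : expR y = expR m * expR (y - m) by rewrite -expRD subrKC.
  by rewrite ler_wpM2l ?expR_ge0// expR_ge1Dx.
have -> : expR m = l * (expR m * (1 + (x - m))) + (1 - l) * (expR m * (1 + (y - m))).
  by rewrite /m; ring.
by rewrite lerD// ler_wpM2l// subr_ge0.
Qed.


Lemma measurable_subgraph {R : realType} (f : R -> R) :
  measurable_fun setT f ->
  measurable [set p : (measurableTypeR R * measurableTypeR R)%type | 0 <= p.1 < f p.2].
Proof.
move=> mf; set A := mkset _.
have -> : A = (fun p : measurableTypeR R * measurableTypeR R => 0 <= p.1)
      @^-1` [set true] `&`
    (fun p : measurableTypeR R * measurableTypeR R => p.1 < f p.2) @^-1` [set true].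
  apply/seteqP; split => p; rewrite /A/=; first by move=> /andP[].
  by move=> [-> ->].
apply: measurableI.
- have : measurable_fun setT (fun p : measurableTypeR R * measurableTypeR R => 0 <= p.1).
    by apply: measurable_fun_ler => //; exact: measurable_fst.
  by move=> /(_ measurableT [set true]); rewrite setTI; exact.
- have : measurable_fun setT (fun p : measurableTypeR R * measurableTypeR R => p.1 < f p.2).
    apply: measurable_fun_ltr; first exact: measurable_fst.
    by apply: measurableT_comp => //; exact: measurable_snd.
  by move=> /(_ measurableT [set true]); rewrite setTI; exact.
Qed.

Lemma layer_cake {R : realType} (f : R -> R) :
  measurable_fun setT f -> (forall x, 0 <= f x) ->
  (\int[leb]_x (f x)%:E = \int[leb]_r leb [set x | (0 <= r < f x)%R])%E.
Proof.
move=> mf f0.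
have mA := measurable_subgraph _ mf; set A := (X in measurable X) in mA.
have H := @product_measure_unique _ _ _ _ R leb leb (leb \x^ leb)%E
  (fun X Y mX mY => product_measure2E _ _ mX mY) A mA.
transitivity ((leb \x^ leb) A)%E.
  apply: eq_integral => x _ /=.
  have -> : ysection A x = `[0, f x[%classic.
    by apply/seteqP; split => r; rewrite /ysection/A/= ?inE/= ?in_itv/=.
  rewrite lebesgue_measure_itv/= lte_fin sube0; case: ltP => // fx0.
  by congr EFin; apply/eqP; rewrite eq_le fx0 f0.
rewrite -H; apply: eq_integral => r _ /=; congr (leb _).
by apply/seteqP; split => x; rewrite /xsection/A/= ?inE.
Qed.

Lemma measurable_superlevel {R : realType} (f : R -> R) (r : R) :
  measurable_fun setT f -> measurable [set x | 0 <= r < f x].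
Proof.
move=> mf; have [r0|r0] := leP 0 r; last first.
  by rewrite (_ : mkset _ = set0)//; apply/seteqP; split.
rewrite (_ : mkset _ = setT `&` f @^-1` `]r, +oo[).
  by apply: mf => //; exact: measurable_itv.
by apply/seteqP; split => x /=; rewrite in_itv/= andbT // => -[].
Qed.

(** One-dimensional Brunn-Minkowski for symmetric intervals: for [x] in [A] and [y] in [B], [C]
    contains the interval of radius [l * |x| + (1 - l) * |y|], while [A] and [B] lie in intervals
    whose radii are the suprema of [|x|] and [|y|]. *)
Lemma symmetric_interval_combination {R : realType} (A B C : set R) (l : R) :
  0 < l < 1 -> measurable A -> measurable B -> measurable C -> A 0 -> B 0 ->
  (forall x y, `|x| <= `|y| -> A y -> A x) ->
  (forall x y, `|x| <= `|y| -> B y -> B x) ->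
  (forall x y, A x -> B y -> C (l * x + (1 - l) * y)) ->
  (l%:E * leb A + (1 - l)%:E * leb B <= leb C)%E.
Proof.
move=> /andP[l0 l1] mA mB mC A0 B0 sA sB ABC.
have l1' : 0 < 1 - l by rewrite subr_gt0.
have itvle (r : R) : 0 <= r -> leb `[- r, r]%classic = (r * 2)%:E.
  move=> r0; rewrite lebesgue_measure_itv/= lte_fin -EFinD.
  case: ltP => h; congr EFin; first by ring.
  by apply/eqP; rewrite eq_le; apply/andP; split; lra.
have key x y : A x -> B y -> (((l * `|x| + (1 - l) * `|y|) * 2)%:E <= leb C)%E.
  move=> Ax By; set M := (X in (X * 2)%:E).
  have M0 : 0 <= M by rewrite addr_ge0// mulr_ge0// ltW.
  rewrite -itvle//; apply: le_measure; rewrite ?inE//.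
  move=> z; rewrite /= in_itv/= => zM.
  have {}zM : `|z| <= M by rewrite ler_norml.
  have [M00|M00] := eqVneq M 0.
    have -> : z = l * 0 + (1 - l) * 0.
      by rewrite !mulr0 addr0; apply/eqP; rewrite -normr_le0 -M00.
    exact: ABC.
  have Mgt0 : 0 < M by rewrite lt_neqAle eq_sym M00.
  (* Every point of the interval is reached by scaling [|x|] and [|y|] by the same ratio [z / M],
     which lies in [-1, 1], so the scaled points stay in [A] and [B]. *)
  have -> : z = l * (`|x| * (z / M)) + (1 - l) * (`|y| * (z / M)).
    rewrite !mulrA -mulrDl -mulrDl -/M mulrC mulrA mulVf ?mul1r//.
  have zM1 : `|z / M| <= 1 by rewrite normrM normfV (ger0_norm M0) ler_pdivrMr ?mul1r.
  by apply: ABC; [apply: sA Ax|apply: sB By]; rewrite normrM normr_id ler_piMr.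
have := measure_ge0 leb C.
case E : (leb C) => [c| |]; rewrite ?leey// => c0.
have {}key x y : A x -> B y -> l * `|x| + (1 - l) * `|y| <= c / 2.
  by move=> Ax By; rewrite ler_pdivlMr// -lee_fin -E key.
pose SA := sup [set `|x| | x in A]; pose SB := sup [set `|x| | x in B].
have hA : has_ubound [set `|x| | x in A].
  exists (c / 2 / l) => _ [x Ax <-]; rewrite ler_pdivlMr// mulrC.
  by have := key _ _ Ax B0; rewrite normr0 mulr0 addr0.
have hB : has_ubound [set `|x| | x in B].
  exists (c / 2 / (1 - l)) => _ [x Bx <-]; rewrite ler_pdivlMr// mulrC.
  by have := key _ _ A0 Bx; rewrite normr0 mulr0 add0r.
have SA0 : 0 <= SA by apply: ub_le_sup => //; exists 0 => //; rewrite normr0.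
have SB0 : 0 <= SB by apply: ub_le_sup => //; exists 0 => //; rewrite normr0.
have leA : (leb A <= (SA * 2)%:E)%E.
  rewrite -itvle//; apply: le_measure; rewrite ?inE// => x Ax /=.
  by rewrite in_itv/= -ler_norml; apply: ub_le_sup => //; exists x.
have leB : (leb B <= (SB * 2)%:E)%E.
  rewrite -itvle//; apply: le_measure; rewrite ?inE// => x Ax /=.
  by rewrite in_itv/= -ler_norml; apply: ub_le_sup => //; exists x.
have keyS : l * SA + (1 - l) * SB <= c / 2.
  rewrite -lerBrDr mulrC -ler_pdivlMr//; apply: ge_sup.
    by exists `|0 : R|, 0.
  move=> _ [x Ax <-]; rewrite ler_pdivlMr// lerBrDr mulrC addrC -lerBrDr.
  rewrite [leLHS]mulrC -ler_pdivlMr//; apply: ge_sup; first by exists `|0 : R|, 0.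
  by move=> _ [y By <-]; rewrite ler_pdivlMr//; have := key _ _ Ax By; lra.
apply: (@le_trans _ _ (l%:E * (SA * 2)%:E + (1 - l)%:E * (SB * 2)%:E)%E).
  by apply: leeD; apply: lee_wpmul2l => //; rewrite lee_fin ltW.
  by rewrite -!EFinM -EFinD lee_fin; lra.
have : (0 <= leb C)%E by exact: c0.
by rewrite E.
Qed.

(** Layer cake reduces the claim to superlevel sets, which are symmetric intervals. The common peak
    [f 0 = g 0] makes those of [f] and [g] empty at the same levels, and this yields the arithmetic
    rather than the geometric mean of the integrals. *)
Lemma prekopa_even {R : realType} (f g h : R -> R) (l : R) : 0 < l < 1 ->
  measurable_fun setT f -> measurable_fun setT g -> measurable_fun setT h ->
  (forall x, 0 <= f x) -> (forall x, 0 <= g x) -> (forall x, 0 <= h x) ->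
  (forall x y, `|x| <= `|y| -> f y <= f x) ->
  (forall x y, `|x| <= `|y| -> g y <= g x) ->
  f 0 = g 0 ->
  (forall x y, minr (f x) (g y) <= h (l * x + (1 - l) * y)) ->
  (l%:E * \int[leb]_x (f x)%:E + (1 - l)%:E * \int[leb]_x (g x)%:E
    <= \int[leb]_x (h x)%:E)%E.
Proof.
move=> l01 mf mg mh f0 g0 h0 sf sg fg0 fgh.
have /andP[l0 l1] := l01.
have l1' : 0 < 1 - l by rewrite subr_gt0.
have l0w := ltW l0; have l1w := ltW l1'.
have mslice (k : R -> R) (mk : measurable_fun setT k) :
    measurable_fun setT (fun r : measurableTypeR R => leb [set x : R | (0 <= r < k x)%R]).
  have := @measurable_fun_xsection _ _ _ _ R leb _ (measurable_subgraph _ mk).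
  congr (measurable_fun _ _); apply/funext => r /=; congr (leb _).
  by apply/seteqP; split => x; rewrite /xsection/= ?inE.
rewrite !layer_cake// -!ge0_integralZl_EFin//; last 2 first.
  exact: mslice.
  exact: mslice.
rewrite -ge0_integralD//; first last.
- by apply: measurable_funeM; exact: mslice.
- by move=> r _; rewrite mule_ge0// lee_fin ltW.
- by apply: measurable_funeM; exact: mslice.
- by move=> r _; rewrite mule_ge0// lee_fin ltW.
apply: ge0_le_integral => //=.
- by move=> r _; rewrite adde_ge0// mule_ge0.
- by apply: emeasurable_funD; apply: measurable_funeM; exact: mslice.
- exact: mslice.
move=> r _.
have [r0|] := boolP (r < 0).
  have E (k : R -> R) : [set x | 0 <= r < k x] = set0.
    by apply/seteqP; split => x //=; rewrite leNgt r0.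
  by rewrite !E measure0 !mule0 adde0.
rewrite -leNgt => r0.
have [rf|fr] := ltP r (f 0); last first.
  have -> : [set x | 0 <= r < f x] = set0.
    apply/seteqP; split => x //= /andP[_]; rewrite ltNge => /negP; apply.
    by apply: le_trans fr; apply: sf; rewrite normr0.
  have -> : [set x | 0 <= r < g x] = set0.
    apply/seteqP; split => x //= /andP[_]; rewrite ltNge => /negP; apply.
    by apply: le_trans fr; rewrite fg0; apply: sg; rewrite normr0.
  by rewrite measure0 !mule0 adde0.
apply: symmetric_interval_combination => //=; try exact: measurable_superlevel.
- by rewrite r0.
- by rewrite r0 -fg0.
- by move=> x y xy; rewrite r0/= => /lt_le_trans; apply; exact: sf.
- by move=> x y xy; rewrite r0/= => /lt_le_trans; apply; exact: sg.
- move=> x y; rewrite r0/= => rfx rgy; apply: lt_le_trans (fgh x y).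
  by rewrite lt_min rfx.
Qed.

(** Tilting by [p = - ln (G u)] and [q = - ln (G v)] gives both integrands the same peak at 0, so
    that [prekopa_even] applies; convexity of the exponential then trades these tilts for the given
    [al] and [be]. *)
Lemma log_concave_gaussian_convolution {R : realType} (G H : R -> R) (c : R) :
  log_concave G -> {homo G : x y / x <= y} -> (forall x, 0 <= G x) -> 0 <= c ->
  (forall s, (H s)%:E = \int[leb]_x (normal_pdf 0 1 x * G (s - c * x ^+ 2))%:E)%E ->
  log_concave H.
Proof.
move=> lcG ndG G0 c0 HE al be u v l l01.
have H0 s : 0 <= H s.
  rewrite -lee_fin HE; apply: integral_ge0 => x _.
  by rewrite lee_fin mulr_ge0// normal_pdf_ge0.
have [->|ln0] := eqVneq l 0.
  by rewrite !mul0r subr0 !mul1r !add0r ge_min lexx orbT.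
have [->|ln1] := eqVneq l 1.
  by rewrite subrr !mul0r !mul1r !addr0 ge_min lexx.
have l01' : 0 < l < 1 by rewrite !lt_neqAle eq_sym ln0 ln1 (andP l01).1 (andP l01).2.
have [l0 l1] := andP l01'; have l1' : 0 < 1 - l by rewrite subr_gt0.
have l0w := ltW l0; have l1w := ltW l1'.
have HG0 s : G s = 0 -> H s = 0.
  move=> Gs; apply: EFin_inj; rewrite HE; apply: integral0_eq => x _.
  have -> : G (s - c * x ^+ 2) = 0.
    apply/eqP; rewrite eq_le G0 andbT -Gs ndG//.
    by rewrite gerBl mulr_ge0// sqr_ge0.
  by rewrite mulr0.
have [Gu|Gu] := eqVneq (G u) 0.
  by rewrite ge_min HG0// mulr0 mulr_ge0 ?expR_ge0.
have [Gv|Gv] := eqVneq (G v) 0.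
  by rewrite ge_min (HG0 v)// mulr0 mulr_ge0 ?expR_ge0 ?orbT.
have {}Gu : 0 < G u by rewrite lt_neqAle eq_sym Gu G0.
have {}Gv : 0 < G v by rewrite lt_neqAle eq_sym Gv G0.
pose p := - ln (G u); pose q := - ln (G v).
have pu : expR p * G u = 1 by rewrite expRN lnK// mulVf// gt_eqF.
have qv : expR q * G v = 1 by rewrite expRN lnK// mulVf// gt_eqF.
set m := l * u + (1 - l) * v.
pose F (t w x : R) := expR t * (normal_pdf 0 1 x * G (w - c * x ^+ 2)).
have mG w : measurable_fun setT (fun x : R => G (w - c * x ^+ 2)).
  apply: measurableT_comp.
    by apply: nondecreasing_measurable.
  by apply: measurable_funB => //; apply: measurable_funM.
have mF t w : measurable_fun setT (F t w).
  apply: measurable_funM => //; apply: measurable_funM => //.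
  exact: measurable_normal_pdf.
have F0 t w x : 0 <= F t w x.
  by rewrite /F mulr_ge0 ?expR_ge0// mulr_ge0// normal_pdf_ge0.
have pdfE (x : R) : normal_pdf 0 1 x = normal_peak 1 * expR (- (x ^+ 2 / 2)).
  by rewrite normal_pdfE ?oner_neq0// /normal_fun subr0 expr1n mulNr.
have FE t w x : F t w x = normal_peak 1 * (expR (t - x ^+ 2 / 2) * G (w - c * x ^+ 2)).
  by rewrite /F pdfE expRD; ring.
have sF t w x y : `|x| <= `|y| -> F t w y <= F t w x.
  move=> xy.
  have xy2 : x ^+ 2 <= y ^+ 2 by rewrite -real_normK ?num_real// -[leRHS]real_normK ?num_real// lerXn2r ?nnegrE.
  rewrite !FE ler_wpM2l ?normal_peak_ge0// ler_pM ?expR_ge0//.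
    by rewrite ler_expR; lra.
  by apply: ndG; rewrite lerD2l lerN2 ler_wpM2l.
have intF t w : (\int[leb]_x (F t w x)%:E = (expR t * H w)%:E)%E.
  under eq_integral do rewrite EFinM.
  rewrite ge0_integralZl_EFin ?expR_ge0//; first by rewrite EFinM HE.
  - by move=> x _; rewrite lee_fin mulr_ge0// normal_pdf_ge0.
  - apply/measurable_EFinP; apply: measurable_funM; last exact: mG.
    exact: measurable_normal_pdf.
have := @prekopa_even R (F p u) (F q v) (F (l * p + (1 - l) * q) m) l l01'
  (mF _ _) (mF _ _) (mF _ _) (F0 _ _) (F0 _ _) (F0 _ _) (sF _ _) (sF _ _).
rewrite !intF -!EFinM -EFinD lee_fin.
have -> : F p u 0 = F q v 0.
  by rewrite !FE expr0n/= !mul0r !mulr0 !subr0 pu qv.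
move=> /(_ erefl) pre.
(* The pointwise hypothesis combines log-concavity of [G] for the tilts [p - x^2 / 2] and
   [q - y^2 / 2], convexity of the square and monotonicity of [G]. *)
have key : l * (expR p * H u) + (1 - l) * (expR q * H v) <=
    expR (l * p + (1 - l) * q) * H m.
  apply: pre => x y; rewrite !FE -minr_pMr ?normal_peak_ge0// ler_wpM2l ?normal_peak_ge0//.
  apply: le_trans (lcG _ _ _ _ _ l01) _.
  have cvx : (l * x + (1 - l) * y) ^+ 2 <= l * x ^+ 2 + (1 - l) * y ^+ 2.
    rewrite -subr_ge0.
    have -> : l * x ^+ 2 + (1 - l) * y ^+ 2 - (l * x + (1 - l) * y) ^+ 2 =
      l * (1 - l) * (x - y) ^+ 2 by ring.
    by rewrite mulr_ge0 ?sqr_ge0// mulr_ge0// ltW.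
  rewrite ler_pM ?expR_ge0//.
    by rewrite ler_expR; nra.
  by apply: ndG; rewrite /m; nra.
set t := l * p + (1 - l) * q in key.
set M := minr _ _.
have M0 : 0 <= M by rewrite le_min !mulr_ge0 ?expR_ge0.
(* Since [M] is at most each tilted value, both terms of [key] are bounded below by multiples of
   [M], and the weighted mean of the exponentials dominates the exponential of the mean. *)
have h1 : M * expR (p - al) <= expR p * H u.
  have : M <= expR al * H u by rewrite ge_min lexx.
  move=> /(ler_wpM2r (expR_ge0 (p - al))) /le_trans; apply.
  by rewrite mulrAC -expRD subrKC.
have h2 : M * expR (q - be) <= expR q * H v.
  have : M <= expR be * H v by rewrite ge_min lexx orbT.
  move=> /(ler_wpM2r (expR_ge0 (q - be))) /le_trans; apply.
  by rewrite mulrAC -expRD subrKC.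
have h3 := ler_expR_combination l (p - al) (q - be) l01.
have h4 : M * expR (l * (p - al) + (1 - l) * (q - be)) <= expR t * H m.
  apply: le_trans key; apply: le_trans (ler_wpM2l M0 h3) _.
  rewrite mulrDr [M * (l * _)]mulrCA [M * ((1 - l) * _)]mulrCA.
  by rewrite lerD// ler_wpM2l// ltW.
have -> : expR (l * al + (1 - l) * be) =
    expR t * expR (- (l * (p - al) + (1 - l) * (q - be))).
  by rewrite -expRD /t; congr expR; ring.
rewrite mulrAC expRN -ler_pdivrMr ?invr_gt0 ?expR_gt0// invrK.
exact: h4.
Qed.

(** * Laplace transforms *)

Lemma ge0_integral_translation {R : realType} (f : R -> \bar R) (c : R) :
  measurable_fun setT f -> (forall t, 0 <= f t)%E ->
  (\int[leb]_t f (t - c)%R = \int[leb]_t f t)%E.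
Proof.
move=> mf f0.
have mshift : measurable_fun setT (fun t : measurableTypeR R => t - c : measurableTypeR R).
  exact: measurable_funB.
have leb_shift (A : set R) : measurable A ->
    pushforward leb (fun t : measurableTypeR R => t - c : measurableTypeR R) A = leb A.
  move=> mA; apply/esym.
  have [m' m'E] : exists m' : {measure set (measurableTypeR R) -> \bar R},
    m' = pushforward leb (fun t : measurableTypeR R => t - c : measurableTypeR R) :> (set _ -> _).
    by exists (measure_function_pushforward__canonical__measure_function_Measure leb mshift).
  rewrite -m'E; apply: lebesgue_measure_unique => //= _ [[a b]] _ <-.
  rewrite m'E /pushforward.
  have -> : (fun t => t - c) @^-1` [set` `]a, b]%R] = `]a + c, b + c]%classic.
    by apply/seteqP; split => t /=; rewrite !in_itv/= ltrBrDr lerBlDr.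
  by rewrite !lebesgue_measure_itv/= !lte_fin ltrD2r -!EFinD opprD addrACA subrr addr0.
transitivity (\int[pushforward leb (fun t : measurableTypeR R => (t - c)%R : measurableTypeR R)]_t f t)%E.
  by rewrite ge0_integral_pushforward.
by apply: eq_measure_integral => A mA _; exact: leb_shift.
Qed.

(** Up to the factor [s = (1 + 2 b)^(-1/2)], the integrand is the centred normal density of standard
    deviation [s]. *)
Lemma integral_normal_pdf_expR {R : realType} (b : R) : 0 <= b ->
  (\int[leb]_x (normal_pdf 0 1 x * expR (- (b * x ^+ 2)))%:E =
   (Num.sqrt (1 + 2 * b))^-1%:E)%E.
Proof.
move=> b0; set k := 1 + 2 * b.
have k0 : 0 < k by rewrite /k; lra.
pose s := (Num.sqrt k)^-1.
have s0 : 0 < s by rewrite invr_gt0 sqrtr_gt0.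
have s2 : s ^+ 2 = k^-1 by rewrite exprVn sqr_sqrtr// ltW.
have E (x : R) : normal_pdf 0 1 x * expR (- (b * x ^+ 2)) = s * normal_pdf 0 s x.
  rewrite !normal_pdfE ?oner_neq0 ?gt_eqF// /normal_fun !subr0.
  have -> : normal_peak 1 = s * normal_peak s :> R.
    rewrite /normal_peak expr1n mul1r -mulrnAr sqrtrM ?sqr_ge0// sqrtr_sqr ger0_norm ?ltW//.
    by rewrite invfM mulrA mulfV ?gt_eqF// mul1r.
  rewrite mulrAC -mulrA -mulrA; congr (_ * (_ * _)); rewrite -expRD; congr expR.
  have -> : (s ^+ 2 *+ 2)^-1 = k / 2 by rewrite s2 -mulr_natr invfM invrK.
  have -> : (1 ^+ 2 *+ 2)^-1 = 2^-1 :> R by rewrite expr1n.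
  by rewrite /k; field.
under eq_integral do rewrite E EFinM.
rewrite ge0_integralZl_EFin ?ltW//.
- by rewrite integral_normal_pdf mule1.
- by move=> x _; rewrite lee_fin normal_pdf_ge0.
- by apply/measurable_EFinP; exact: measurable_normal_pdf.
Qed.

Definition laplace {R : realType} (G : R -> R) (theta : R) : \bar R :=
  (\int[leb]_t (expR (- (theta * t)) * G t)%:E)%E.

Lemma measurable_expR_tilt {R : realType} (theta : R) :
  measurable_fun setT (fun t : R => expR (- (theta * t))).
Proof. by apply: measurableT_comp => //; apply: measurableT_comp => //; exact: measurable_funM. Qed.

(** After exchanging the integrals, the shift by [c x^2] in the inner one leaves the factor
    [exp (- theta c x^2)], whose Gaussian mean is the inverse square root. *)
Lemma laplace_gaussian_convolution {R : realType} (G H : R -> R) (c theta : R) :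
  {homo G : x y / x <= y} -> (forall x, 0 <= G x) -> 0 <= c -> 0 <= theta ->
  (forall s, (H s)%:E = \int[leb]_x (normal_pdf 0 1 x * G (s - c * x ^+ 2))%:E)%E ->
  laplace H theta = ((Num.sqrt (1 + 2 * (theta * c)))^-1%:E * laplace G theta)%E.
Proof.
move=> ndG G0 c0 t0 HE.
have mG : measurable_fun setT G by exact: nondecreasing_measurable.
pose F (p : measurableTypeR R * measurableTypeR R) : \bar R :=
  (expR (- (theta * p.1)) * (normal_pdf 0 1 p.2 * G (p.1 - c * p.2 ^+ 2)))%:E.
have mF : measurable_fun setT F.
  apply/measurable_EFinP; apply: measurable_funM.
    by apply: (measurableT_comp (measurable_expR_tilt theta)); exact: measurable_fst.
  apply: measurable_funM.
    by apply: (measurableT_comp (measurable_normal_pdf 0 1)); exact: measurable_snd.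
  apply: (measurableT_comp mG); apply: measurable_funB; first exact: measurable_fst.
  apply: measurable_funM => //; apply: measurable_funX; exact: measurable_snd.
have F0 p : (0 <= F p)%E.
  by rewrite lee_fin mulr_ge0 ?expR_ge0// mulr_ge0// normal_pdf_ge0.
have mGx (s : R) : measurable_fun setT
    (fun x : R => normal_pdf 0 1 x * G (s - c * x ^+ 2)).
  apply: measurable_funM; first exact: measurable_normal_pdf.
  by apply: (measurableT_comp mG); apply: measurable_funB => //; apply: measurable_funM.
transitivity (\int[leb]_t \int[leb]_x F (t, x))%E.
  apply: eq_integral => t _.
  under eq_integral do rewrite /F/= EFinM.
  rewrite ge0_integralZl_EFin ?expR_ge0//.
  - by rewrite -HE.
  - by move=> x _; rewrite lee_fin mulr_ge0// normal_pdf_ge0.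
  - by apply/measurable_EFinP; exact: mGx.
rewrite fubini_tonelli//.
have mtG : measurable_fun setT (fun t : R => (expR (- (theta * t)) * G t)%:E).
  apply/measurable_EFinP; apply: measurable_funM => //.
  exact: measurable_expR_tilt.
have tG0 t : (0 <= (expR (- (theta * t)) * G t)%:E)%E.
  by rewrite lee_fin mulr_ge0 ?expR_ge0.
have lap0 : (0 <= laplace G theta)%E by apply: integral_ge0.
transitivity (\int[leb]_x ((normal_pdf 0 1 x * expR (- (theta * c * x ^+ 2)))%:E * laplace G theta))%E.
  apply: eq_integral => x _.
  rewrite /laplace -(ge0_integral_translation _ (c * x ^+ 2))//.
  rewrite -ge0_integralZl_EFin//.
  - apply: eq_integral => t _; rewrite /F/= -EFinM; congr EFin.
    have -> : expR (- (theta * t)) = expR (- (theta * c * x ^+ 2)) *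
      expR (- (theta * (t - c * x ^+ 2))) by rewrite -expRD; congr expR; ring.
    by ring.
  - apply: (@measurableT_comp _ _ _ _ _ _ (fun t : R => (expR (- (theta * t)) * G t)%:E)) => //.
    exact: measurable_funB.
  - by rewrite mulr_ge0 ?expR_ge0// normal_pdf_ge0.
rewrite ge0_integralZr//.
- by rewrite integral_normal_pdf_expR// mulr_ge0.
- apply/measurable_EFinP; apply: measurable_funM; first exact: measurable_normal_pdf.
  by apply: measurableT_comp => //; apply: measurableT_comp => //; apply: measurable_funM.
- by move=> x _; rewrite lee_fin mulr_ge0 ?expR_ge0// normal_pdf_ge0.
Qed.

Lemma laplace_heaviside {R : realType} (theta : R) : 0 < theta ->
  laplace (fun t => (0 < t)%R%:R) theta = theta^-1%:E.
Proof.
move=> t0; have ti0 : 0 <= theta^-1 by rewrite invr_ge0 ltW.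
have mE : measurable_fun setT (fun t : R => (theta * expR (- theta * t))%:E).
  apply/measurable_EFinP; apply: measurable_funM => //.
  by apply: measurableT_comp => //; exact: measurable_funM.
rewrite -[RHS]mule1 -(integral_exponential_pdf t0) -ge0_integralZl_EFin//; first last.
- by apply/measurable_EFinP; exact: measurable_exponential_pdf.
- by move=> x _; rewrite lee_fin exponential_pdf_ge0// ltW.
transitivity (\int[leb]_(t in `]0%R, +oo[) (theta^-1 * (theta * expR (- theta * t)))%:E)%E.
  rewrite [RHS]integral_mkcond; apply: eq_integral => t _.
  rewrite patchE; case: ifPn; rewrite ?inE ?notin_setE /= in_itv/= andbT.
    by move=> ->; rewrite mulr1 mulrA mulVf ?gt_eqF// mul1r mulNr.
  by move/negP/negbTE => ->; rewrite mulr0.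
rewrite integral_itv_obnd_cbnd; last first.
  apply: measurable_funTS; under eq_fun do rewrite EFinM; exact: measurable_funeM.
rewrite [LHS]integral_mkcond; apply: eq_integral => t _.
rewrite /exponential_pdf !patchE; case: ifPn => _; last by rewrite mule0.
by rewrite -EFinM.
Qed.

(** * Laplace factors of the single terms and the weights [wt] *)

Definition wt {R : realType} (a : nat -> R) (theta : R) (i : nat) : R :=
  (a i ^+ 2 + 2 * theta)^-1.

(** The Laplace transform of [x^2 / a_i^2] for a standard normal [x]; its logarithmic derivative in
    [theta] is [- wt a theta i]. *)
Definition laplace_factor {R : realType} (a : nat -> R) (theta : R) (i : nat) : R :=
  (Num.sqrt (1 + 2 * (theta * (a i ^+ 2)^-1)))^-1.

(** With [z = 2 y^2 - y] one has [(1 + z) (1 + y) = 1 + y^2 (1 + 2 y) >= 1], and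
    [exp z >= 1 + z]. *)
Lemma expR_le1Dx {R : realType} (y : R) : - 2^-1 <= y ->
  expR (y - 2 * y ^+ 2) <= 1 + y.
Proof.
move=> y2; set z := 2 * y ^+ 2 - y.
have z0 : 0 < 1 + z by rewrite /z; nra.
have -> : y - 2 * y ^+ 2 = - z by rewrite /z; ring.
rewrite expRN -[leRHS]mul1r -ler_pdivrMr; last by lra.
rewrite -invfM invf_le1 ?mulr_gt0 ?expR_gt0//; last by lra.
apply: (@le_trans _ _ ((1 + z) * (1 + y))); first by rewrite /z; nra.
by rewrite ler_wpM2r ?expR_ge1Dx//; lra.
Qed.

(** The ratio of the two factors is [(1 + y)^(-1/2)] with [y = 2 h wt]; as [wt <= 1 / (2 theta)],
    the bound on [h] gives [y >= -1/2], the range of the second-order estimate. *)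
Lemma laplace_factor_shift {R : realType} (a : nat -> R) (theta h : R) (i : nat) :
  0 < a i -> 0 < theta -> `|h| <= theta / 2 ->
  laplace_factor a (theta + h) i <=
  laplace_factor a theta i * expR (- h * wt a theta i + 4 * h ^+ 2 * wt a theta i ^+ 2).
Proof.
move=> ai0 t0; rewrite ler_norml => /andP[h1 h2].
have a20 : 0 < a i ^+ 2 by rewrite exprn_gt0.
rewrite /laplace_factor; set w := wt a theta i.
set A := 1 + 2 * (theta * _).
have w0 : 0 < w by rewrite invr_gt0; lra.
have A0 : 0 < A by rewrite /A addr_gt0// mulr_gt0// mulr_gt0// invr_gt0.
pose y := 2 * h * w.
have wd : w * (a i ^+ 2 + 2 * theta) = 1.
  by rewrite mulVf// gt_eqF//; lra.
have y2 : - 2^-1 <= y by rewrite /y; nra.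
have -> : 1 + 2 * ((theta + h) * (a i ^+ 2)^-1) = A * (1 + y).
  rewrite /A /y /w /wt; field.
  by apply/andP; split; rewrite gt_eqF//; lra.
have y0 : 0 < 1 + y by lra.
rewrite (sqrtrM _ (ltW A0)) invfM ler_wpM2l ?invr_ge0 ?sqrtr_ge0//.
have -> : - h * w + 4 * h ^+ 2 * w ^+ 2 = - (y / 2 - y ^+ 2).
  by rewrite /y; field.
rewrite expRN lef_pV2 ?posrE ?expR_gt0 ?sqrtr_gt0//.
rewrite -(ler_pXn2r (ltn0Sn 1)) ?nnegrE ?expR_ge0 ?sqrtr_ge0// (sqr_sqrtr (ltW y0)).
rewrite expr2 -expRD; apply: le_trans (expR_le1Dx _ y2).
by rewrite ler_expR; lra.
Qed.

(** From [1 + 2 x <= exp (2 x)] with [x = theta / a_i^2]. It bounds the infinite product below by a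
    positive number, the [1 / a_i^2] being summable. *)
Lemma laplace_factor_ge {R : realType} (a : nat -> R) (theta : R) (i : nat) :
  0 < a i -> 0 < theta -> expR (- theta * (a i ^+ 2)^-1) <= laplace_factor a theta i.
Proof.
move=> ai0 t0; have a20 : 0 < (a i ^+ 2)^-1 by rewrite invr_gt0 exprn_gt0.
rewrite /laplace_factor mulNr expRN; set x := theta * _.
have x0 : 0 < x by rewrite mulr_gt0.
rewrite lef_pV2 ?posrE ?expR_gt0 ?sqrtr_gt0//; last by lra.
rewrite -(ler_pXn2r (ltn0Sn 1)) ?nnegrE ?expR_ge0 ?sqrtr_ge0// sqr_sqrtr; last by lra.
by rewrite expr2 -expRD; apply: le_trans (expR_ge1Dx _); lra.
Qed.

Lemma laplace_factor_gt0 {R : realType} (a : nat -> R) (theta : R) (i : nat) :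
  0 < a i -> 0 < theta -> 0 < laplace_factor a theta i.
Proof. by move=> a0 t0; apply: lt_le_trans (laplace_factor_ge _ _ _ a0 t0); exact: expR_gt0. Qed.

Lemma prod_laplace_factor_shift {R : realType} (a : nat -> R) (theta h : R) (n : nat) :
  (forall i, 0 < a i) -> 0 < theta -> `|h| <= theta / 2 ->
  \prod_(i < n) laplace_factor a (theta + h) i <=
  \prod_(i < n) laplace_factor a theta i *
  expR (- h * series (wt a theta) n + 4 * h ^+ 2 * series (fun i => wt a theta i ^+ 2) n).
Proof.
move=> a0 t0 h2.
have th0 : 0 < theta + h by move: h2; rewrite ler_norml => /andP[]; lra.
elim: n => [|n IH].
  by rewrite !big_ord0 /series/= !big_geq// !mulr0 addr0 expR0 mulr1.
rewrite !big_ord_recr /=.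
have -> : - h * series (wt a theta) n.+1 + 4 * h ^+ 2 * series (fun i => wt a theta i ^+ 2) n.+1 =
  (- h * series (wt a theta) n + 4 * h ^+ 2 * series (fun i => wt a theta i ^+ 2) n) +
  (- h * wt a theta n + 4 * h ^+ 2 * wt a theta n ^+ 2).
  by rewrite !seriesSr; ring.
rewrite expRD mulrACA ler_pM//.
- by apply: prodr_ge0 => i _; rewrite ltW ?laplace_factor_gt0.
- by rewrite ltW ?laplace_factor_gt0.
- exact: laplace_factor_shift.
Qed.

Lemma prod_laplace_factor_ge {R : realType} (a : nat -> R) (theta : R) (n : nat) :
  (forall i, 0 < a i) -> 0 < theta ->
  expR (- theta * series (fun i => (a i ^+ 2)^-1) n) <=
  \prod_(i < n) laplace_factor a theta i.
Proof.
move=> a0 t0; elim: n => [|n IH].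
  by rewrite big_ord0 /series/= big_geq// mulr0 expR0.
rewrite big_ord_recr /= seriesSr mulrDr expRD ler_pM ?expR_ge0//.
exact: laplace_factor_ge.
Qed.

Section weights.
Context {R : realType} (a : nat -> R).
Hypothesis a0 : forall i, 0 < a i.
Hypothesis cvg_a : cvgn (series (fun i => ((a i) ^+ 2)^-1)).

Lemma wt_gt0 theta i : 0 < theta -> 0 < wt a theta i.
Proof. by move=> t0; rewrite invr_gt0 addr_gt0 ?exprn_gt0// mulr_gt0. Qed.

Lemma wt_ge0 (theta : R) i : 0 < theta -> 0 <= wt a theta i.
Proof. by move=> t0; apply/ltW/wt_gt0. Qed.

Lemma wt_le theta i : 0 < theta -> wt a theta i <= (a i ^+ 2)^-1.
Proof.
move=> t0; have ai : 0 < a i ^+ 2 by rewrite exprn_gt0.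
by rewrite lef_pV2 ?posrE//; lra.
Qed.

Lemma wt_le_theta theta i : 0 < theta -> wt a theta i <= (2 * theta)^-1.
Proof.
move=> t0; have ai : 0 < a i ^+ 2 by rewrite exprn_gt0.
by rewrite lef_pV2 ?posrE//; lra.
Qed.

Lemma is_cvg_wt theta : 0 < theta -> cvgn (series (wt a theta)).
Proof.
move=> t0; apply: series_le_cvg cvg_a => i.
- exact: wt_ge0.
- by rewrite invr_ge0 exprn_ge0 ?ltW.
- exact: wt_le.
Qed.

Lemma is_cvg_wtM theta theta' : 0 < theta -> 0 < theta' ->
  cvgn (series (fun i => wt a theta i * wt a theta' i)).
Proof.
move=> t0 t'0; have i0 : 0 <= (2 * theta)^-1 by rewrite invr_ge0 mulr_ge0 ?ltW.
apply: (@series_le_cvg _ _ ((2 * theta)^-1 *: wt a theta')) => [i|i|i|].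
- by rewrite mulr_ge0 ?wt_ge0.
- by rewrite mulr_ge0 ?wt_ge0.
- by rewrite ler_wpM2r ?wt_ge0 ?wt_le_theta.
- by apply: is_cvg_seriesZ; exact: is_cvg_wt.
Qed.

(** The quantity [V] of the concentration estimate; differentiating [mu] termwise gives
    [- 2 * wt2]. *)
Definition wt2 theta := limn (series (fun i => wt a theta i ^+ 2)).

Lemma is_cvg_wt2 theta : 0 < theta -> cvgn (series (fun i => wt a theta i ^+ 2)).
Proof. by move=> t0; under eq_fun do rewrite expr2; exact: is_cvg_wtM. Qed.

Lemma muE theta : mu a theta = limn (series (wt a theta)).
Proof. by []. Qed.

End weights.

(** * Laplace transform of the limit distribution function *)

Section laplace_limit.
Context {R : realType} (a : nat -> R) (Gn : nat -> R -> R) (G : R -> R).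
Hypothesis a0 : forall i, 0 < a i.
Hypothesis cvg_a : cvgn (series (fun i => ((a i) ^+ 2)^-1)).
Hypothesis Gn0E : forall s, Gn 0%N s = (0 < s)%R%:R.
Hypothesis ndGn : forall n, {homo Gn n : x y / x <= y}.
Hypothesis Gn01 : forall n s, 0 <= Gn n s <= 1.
Hypothesis GnN : forall n s, s <= 0 -> Gn n s = 0.
Hypothesis GnS : forall n s, ((Gn n.+1 s)%:E = \int[leb]_x
    (normal_pdf 0 1 x * Gn n (s - (a n ^+ 2)^-1 * x ^+ 2))%:E)%E.
Hypothesis cvgG : forall s, Gn ^~ s @ \oo --> G s.

Lemma laplace_GnE n theta : 0 < theta ->
  laplace (Gn n) theta = (theta^-1 * \prod_(i < n) laplace_factor a theta i)%:E.
Proof.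
move=> t0; elim: n => [|n IH].
  by rewrite big_ord0 mulr1 -laplace_heaviside//; congr laplace; exact/funext.
rewrite (@laplace_gaussian_convolution _ (Gn n) _ (a n ^+ 2)^-1)//.
- by rewrite IH -EFinM big_ord_recr/=; congr EFin; rewrite /laplace_factor; ring.
- by move=> s; have /andP[] := Gn01 n s.
- by rewrite invr_ge0 exprn_ge0// ltW.
- exact: ltW.
Qed.

Lemma limit01 s : 0 <= G s <= 1.
Proof.
apply/andP; split.
- by apply: (cvgr_to_ge (cvgG s)); near=> n; have /andP[] := Gn01 n s.
- by apply: (cvgr_to_le (cvgG s)); near=> n; have /andP[] := Gn01 n s.
Unshelve. all: by end_near. Qed.

Lemma limit_homo : {homo G : x y / x <= y}.
Proof.
move=> x y xy; apply: (ler_cvg_to (cvgG x) (cvgG y)).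
by near=> n; exact: ndGn.
Unshelve. all: by end_near. Qed.

Lemma limit_nonpos s : s <= 0 -> G s = 0.
Proof.
move=> s0; have := cvgG s.
have -> : Gn ^~ s = cst 0 by apply/funext => n; exact: GnN.
by move=> /(cvg_unique _ (cvg_cst 0)) => /(_ (@Rhausdorff R)) <-.
Qed.

(** Dominated convergence; the dominating function is the tilted Heaviside function [Gn 0], since
    [Gn n] is at most 1 and vanishes for [t <= 0]. *)
Lemma laplace_cvg theta : 0 < theta ->
  laplace (Gn n) theta @[n --> \oo] --> laplace G theta.
Proof.
move=> t0.
have mE H : {homo H : x y / x <= y} ->
    measurable_fun setT (fun t : R => (expR (- (theta * t)) * H t)%:E).
  move=> ndH; apply/measurable_EFinP; apply: measurable_funM.
    exact: measurable_expR_tilt.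
  exact: nondecreasing_measurable.
have [|//||||] := @dominated_convergence _ _ R leb setT measurableT
  (fun n t => (expR (- (theta * t)) * Gn n t)%:E)
  (fun t => (expR (- (theta * t)) * G t)%:E)
  (fun t => (expR (- (theta * t)) * Gn 0%N t)%:E).
- by move=> n; exact: mE.
- by apply: mE; exact: limit_homo.
- apply: aeW => t _; apply/cvg_EFin; first by near=> n.
  by apply: cvgM (cvgG _); exact: cvg_cst.
- apply/integrableP; split; first exact: mE.
  under eq_integral do rewrite gee0_abs ?lee_fin ?mulr_ge0 ?expR_ge0 ?(andP (Gn01 _ _)).1//.
  by have := laplace_GnE 0 _ t0; rewrite /laplace => ->; rewrite ltry.
- apply: aeW => t n _; rewrite gee0_abs ?lee_fin ?mulr_ge0 ?expR_ge0 ?(andP (Gn01 _ _)).1//.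
  rewrite ler_wpM2l ?expR_ge0// Gn0E.
  by case: ltP => t0'; [have /andP[] := Gn01 n t|rewrite GnN].
- by move=> _ _ h; exact: h.
Unshelve. all: by end_near. Qed.

Lemma laplace_limit theta : 0 < theta ->
  exists2 N, laplace G theta = N%:E &
  theta^-1 * \prod_(i < n) laplace_factor a theta i @[n --> \oo] --> N.
Proof.
move=> t0; have := laplace_cvg _ t0.
under eq_fun do rewrite laplace_GnE//.
have fin : laplace G theta \is a fin_num.
  rewrite ge0_fin_numE; last first.
    by apply: integral_ge0 => t _; rewrite lee_fin mulr_ge0 ?expR_ge0// (andP (limit01 t)).1.
  apply: (@le_lt_trans _ _ (laplace (Gn 0%N) theta)); last by rewrite laplace_GnE// ltry.
  apply: ge0_le_integral => //.
  - by move=> t _; rewrite lee_fin mulr_ge0 ?expR_ge0// (andP (limit01 t)).1.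
  - apply/measurable_EFinP; apply: measurable_funM; first exact: measurable_expR_tilt.
    by apply: nondecreasing_measurable => //; exact: limit_homo.
  - apply/measurable_EFinP; apply: measurable_funM; first exact: measurable_expR_tilt.
    by apply: nondecreasing_measurable => //; exact: ndGn.
  - move=> t _; rewrite lee_fin ler_wpM2l ?expR_ge0// Gn0E.
    by case: ltP => t0'; [have /andP[] := limit01 t|rewrite limit_nonpos].
exists (fine (laplace G theta)); first by rewrite fineK.
by move: H; rewrite -{1}(fineK fin) => /fine_cvg.
Qed.

Lemma laplace_limit_gt0 theta : 0 < theta -> (0 < laplace G theta)%E.
Proof.
move=> t0; have [N -> cvgN] := laplace_limit _ t0.
rewrite lte_fin; apply: (@lt_le_trans _ _ (theta^-1 * expR (- theta * limn (series (fun i => (a i ^+ 2)^-1))))).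
  by rewrite mulr_gt0 ?expR_gt0// invr_gt0.
apply: (cvgr_to_ge cvgN); near=> n.
rewrite ler_wpM2l ?invr_ge0 ?(ltW t0)//; apply: le_trans (prod_laplace_factor_ge _ _ n a0 t0).
rewrite ler_expR !mulNr lerN2 ler_wpM2l ?(ltW t0)//.
apply: nondecreasing_cvgn_le => //.
by apply: nondecreasing_series => i _ _; rewrite invr_ge0 exprn_ge0// ltW.
Unshelve. all: by end_near. Qed.

(** Passage to the limit in the product estimate; the factor 2 absorbs the ratio
    [theta / (theta + h)] of the prefactors. *)
Lemma laplace_limit_shift theta h : 0 < theta -> `|h| <= theta / 2 ->
  (laplace G (theta + h)%R <= (2 * expR (- h * mu a theta + 4 * h ^+ 2 * wt2 a theta))%:E * laplace G theta)%E.
Proof.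
move=> t0 h2.
have [h21 h22] : - (theta / 2) <= h /\ h <= theta / 2 by apply/andP; rewrite -ler_norml.
have th0 : 0 < theta + h by lra.
have [N -> cvgN] := laplace_limit _ t0.
have [N' -> cvgN'] := laplace_limit _ th0.
rewrite -EFinM lee_fin.
have cE : expR (- h * series (wt a theta) n + 4 * h ^+ 2 * series (fun i => wt a theta i ^+ 2) n)
   @[n --> \oo] --> expR (- h * mu a theta + 4 * h ^+ 2 * wt2 a theta).
  apply: continuous_cvg; first exact: continuous_expR.
  apply: cvgD; apply: cvgM; try exact: cvg_cst; [exact: is_cvg_wt|exact: is_cvg_wt2].
rewrite [leRHS]mulrAC.
apply: (ler_cvg_to cvgN' (cvgM (cvgM (cvg_cst (2 : R)) cvgN) cE)).
near=> n.
set Q := (X in _ <= 2 * (_ * X) * _); set E := (X in _ <= _ * _ * X).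
have -> : 2 * (theta^-1 * Q) * E = 2 / theta * (Q * E) by ring.
rewrite ler_pM//.
- by rewrite invr_ge0 ltW.
- by apply: prodr_ge0 => i _; rewrite ltW ?laplace_factor_gt0.
- by rewrite ler_pdivlMr// mulrC ler_pdivrMr//; lra.
- exact: prod_laplace_factor_shift.
Unshelve. all: by end_near. Qed.

End laplace_limit.

(** * Exponentially tilted measures *)

(** Choosing tilts linear in the point turns log-concavity into quasi-concavity of
    [exp (- k t) * G t]. *)
Lemma log_concave_tilt {R : realType} (G : R -> R) (k t m q : R) :
  log_concave G -> t <= m <= q ->
  minr (expR (- (k * t)) * G t) (expR (- (k * q)) * G q) <= expR (- (k * m)) * G m.
Proof.
move=> lcG /andP[tm mq].
have [tq|qt] := ltP t q; last first.
  have -> : m = t by apply/eqP; rewrite eq_le tm (le_trans mq qt).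
  by rewrite ge_min lexx.
pose l := (q - m) / (q - t).
have qt0 : 0 < q - t by rewrite subr_gt0.
have l01 : 0 <= l <= 1.
  apply/andP; split; first by rewrite /l divr_ge0 ?subr_ge0 ?(ltW tq).
  by rewrite /l ler_pdivrMr// mul1r lerD2l lerN2.
have mE : m = l * t + (1 - l) * q by rewrite /l; field; rewrite gt_eqF.
apply: le_trans (lcG _ _ _ _ _ l01) _.
have -> : l * (- (k * t)) + (1 - l) * (- (k * q)) = - (k * m) by rewrite mE; ring.
by rewrite -mE.
Qed.

Lemma integral_itv_le {R : realType} (u : R -> R) (p q r s k : R) :
  measurable_fun setT u -> (forall t, 0 <= u t) -> p < q -> q - p = s - r ->
  (forall t, p < t < q -> u t <= k) -> (forall t, r < t < s -> k <= u t) ->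
  (\int[leb]_(t in `]p, q[) (u t)%:E <= \int[leb]_(t in `]r, s[) (u t)%:E)%E.
Proof.
move=> mu u0 pq pqrs uk ku.
have rs : r < s by rewrite -subr_gt0 -pqrs subr_gt0.
have muE D : measurable_fun D (EFin \o u).
  by apply/measurable_EFinP; apply: measurable_funTS.
have k0 : 0 <= k.
  apply: le_trans (u0 ((p + q) / 2)) (uk _ _).
  by apply/andP; split; lra.
apply: (@le_trans _ _ (\int[leb]_(t in `]p, q[) (cst k%:E t))%E).
  apply: ge0_le_integral; [by []|by move=> t _; rewrite lee_fin|exact: muE|by []|].
  by move=> t /=; rewrite in_itv/= lee_fin; exact: uk.
apply: (@le_trans _ _ (\int[leb]_(t in `]r, s[) (cst k%:E t))%E); last first.
  apply: ge0_le_integral; [by []|by move=> t _; rewrite lee_fin|by []|exact: muE|].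
  by move=> t /=; rewrite in_itv/= lee_fin; exact: ku.
have L (x y : R) : x < y -> leb `]x, y[%classic = (y - x)%:E.
  by move=> xy; rewrite lebesgue_measure_itv/= lte_fin xy -EFinD.
rewrite integral_cst//= integral_cst//=.
by rewrite (L _ _ pq) (L _ _ rs) pqrs.
Qed.

(** * Concentration of the tilted measure around mu(theta) *)

Section window.
Context {R : realType} (a : nat -> R) (G : R -> R).
Hypothesis a0 : forall i, 0 < a i.
Hypothesis cvg_a : cvgn (series (fun i => ((a i) ^+ 2)^-1)).
Hypothesis ndG : {homo G : x y / x <= y}.
Hypothesis G0 : forall s, 0 <= G s.
Hypothesis lapfin : forall theta : R, 0 < theta -> laplace G theta \is a fin_num.
Hypothesis lap0 : forall theta : R, 0 < theta -> (0 < laplace G theta)%E.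
Hypothesis lap_shift : forall theta h : R, 0 < theta -> `|h| <= theta / 2 ->
  (laplace G (theta + h)%R <=
   (2 * expR (- h * mu a theta + 4 * h ^+ 2 * wt2 a theta))%:E * laplace G theta)%E.

Let u (theta t : R) := expR (- (theta * t)) * G t.

Let u0 theta t : 0 <= u theta t. Proof. by rewrite mulr_ge0 ?expR_ge0. Qed.

Let measu theta : measurable_fun setT (u theta).
Proof.
apply: measurable_funM; first exact: measurable_expR_tilt.
exact: nondecreasing_measurable.
Qed.

Let measuE theta D : measurable_fun D (EFin \o u theta).
Proof. by apply/measurable_EFinP; apply: measurable_funTS; exact: measu. Qed.

(* Exponential Markov inequality: h > 0 bounds the left tail and h < 0 the right
   one, and w is chosen so that the resulting factor is 2 exp (-3) <= 1/4. *)
Lemma laplace_tail (theta h w : R) (D : set R) : 0 < theta -> h != 0 -> `|h| <= theta / 2 ->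
  w = 4 * `|h| * wt2 a theta + 3 / `|h| -> measurable D ->
  (forall t, D t -> `|h| * w <= h * (mu a theta - t)) ->
  (\int[leb]_(t in D) (u theta t)%:E <= (4^-1)%:E * laplace G theta)%E.
Proof.
move=> t0 h0 h2 wE mD Dh.
have nh0 : 0 < `|h| by rewrite normr_gt0.
pose c := expR (h * mu a theta - `|h| * w).
apply: (@le_trans _ _ (c%:E * laplace G (theta + h)%R)%E).
  rewrite /laplace -ge0_integralZl_EFin//; last 3 first.
  - by move=> t _; rewrite lee_fin u0.
  - exact: (measuE (theta + h)).
  - exact: expR_ge0.
  apply: (@le_trans _ _ (\int[leb]_(t in D) (c%:E * (expR (- ((theta + h) * t)) * G t)%:E))%E).
    apply: ge0_le_integral => //.
    - by move=> t _; rewrite lee_fin.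
    - exact: measuE.
    - by apply: measurable_funeM; exact: (measuE (theta + h)).
    - move=> t Dt; rewrite -EFinM lee_fin /u mulrA ler_wpM2r// /c -expRD ler_expR.
      by have := Dh _ Dt; rewrite !mulrBr mulrDl; lra.
  apply: ge0_subset_integral => //.
  - by apply: measurable_funeM; exact: (measuE (theta + h)).
  - by move=> t _; rewrite mule_ge0// lee_fin ?expR_ge0 ?u0.
have c0 : (0 <= c%:E)%E by rewrite lee_fin expR_ge0.
apply: le_trans (lee_wpmul2l c0 (lap_shift _ _ t0 h2)) _.
rewrite muleA; apply: lee_wpmul2r; first exact/ltW/lap0.
rewrite -EFinM lee_fin mulrCA /c -expRD.
have -> : h * mu a theta - `|h| * w + (- h * mu a theta + 4 * h ^+ 2 * wt2 a theta) = - (3%:R * 1).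
  rewrite wE -(real_normK (num_real h)); field.
  by rewrite gt_eqF.
rewrite expRN expRM_natl -exprVn.
have e2 : (expR 1)^-1 <= 2^-1 :> R.
  by rewrite lef_pV2 ?posrE ?expR_gt0//; exact: expR_ge1Dx.
have : ((expR 1)^-1 : R) ^+ 3 <= (2^-1) ^+ 3.
  by rewrite lerXn2r ?nnegrE ?invr_ge0 ?expR_ge0.
by move=> h8; rewrite -ler_pdivlMl//; apply: le_trans h8 _; lra.
Qed.

(** If the window carried at most a quarter like each tail, the positive finite total would be at
    most three quarters of itself. *)
Lemma window_mass (theta h w : R) : 0 < theta -> 0 < h -> h <= theta / 2 ->
  w = 4 * h * wt2 a theta + 3 / h -> 0 < w ->
  ((4^-1)%:E * laplace G theta <
    \int[leb]_(t in `](mu a theta - w)%R, (mu a theta + w)%R[) (u theta t)%:E)%E.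
Proof.
move=> t0 h0 h2 wE w0; rewrite ltNge; apply/negP => mid.
set m1 := mu a theta - w in mid *; set m2 := mu a theta + w in mid *.
have hn : `|h| = h by rewrite gtr0_norm.
have hN : `|- h| = h by rewrite normrN.
have low : (\int[leb]_(t in `]-oo, m1]) (u theta t)%:E <= (4^-1)%:E * laplace G theta)%E.
  apply: (laplace_tail _ h w) => //; rewrite ?hn// ?gt_eqF//.
  by move=> t /=; rewrite in_itv/= => tw; rewrite ler_pM2l//; rewrite /m1 in tw; lra.
have high : (\int[leb]_(t in `[m2, +oo[) (u theta t)%:E <= (4^-1)%:E * laplace G theta)%E.
  apply: (laplace_tail _ (- h) w) => //; rewrite ?hN// ?oppr_eq0 ?gt_eqF//.
  move=> t /=; rewrite in_itv/= andbT => tw; rewrite mulNr -mulrN ler_pM2l//.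
  by rewrite /m2 in tw; lra.
have m12 : m1 < m2 by rewrite /m1 /m2; lra.
suff : (laplace G theta <= (3 / 4)%:E * laplace G theta)%E.
  have := lap0 _ t0; rewrite -(fineK (lapfin _ t0)) lte_fin -EFinM lee_fin => l0.
  by rewrite leNgt => /negP; apply; lra.
have split3 : (laplace G theta = \int[leb]_(t in `]-oo, m1]) (u theta t)%:E +
   \int[leb]_(t in `]m1, m2[) (u theta t)%:E +
   \int[leb]_(t in `[m2, +oo[) (u theta t)%:E)%E.
  rewrite -ge0_integral_setU; last 5 first.
  - by [].
  - by [].
  - exact: measuE.
  - by move=> t _; rewrite lee_fin.
  - by apply/disj_setPS => t /= []; rewrite !in_itv/= => tw /andP[wt _]; lra.
  rewrite -ge0_integral_setU; last 5 first.
  - exact: measurableU.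
  - by [].
  - exact: measuE.
  - by move=> t _; rewrite lee_fin.
  - apply/disj_setPS => t /= [[]]; rewrite !in_itv/= andbT.
      by move=> h3 h4; lra.
    by move=> /andP[_ h3] h4; lra.
  rewrite /laplace.
  congr (integral _ _ _); apply/esym/seteqP; split => // t _ /=.
  rewrite !in_itv/= andbT; have [h3|h3] := leP t m1; first by left; left.
  by have [h4|h4] := leP m2 t; [right|left; right].
rewrite [leLHS]split3; apply: (le_trans (leeD (leeD low mid) high)).
rewrite -(fineK (lapfin _ t0)) -!EFinM -!EFinD lee_fin; lra.
Qed.

(** If the tilted function were nondecreasing up to [mu + 3 w], the window would carry no more mass
    than the adjacent interval of the same length [2 w] on its right, which lies in a tail of at
    most a quarter of the total. *)
Lemma window_low (theta h w : R) : 0 < theta -> 0 < h -> h <= theta / 2 ->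
  w = 4 * h * wt2 a theta + 3 / h -> 0 < w ->
  exists t t', [/\ t <= t', t' <= mu a theta + 3 * w & u theta t' < u theta t].
Proof.
move=> t0 h0 h2 wE w0; apply: contrapT => nex.
have nd t t' : t <= t' -> t' <= mu a theta + 3 * w -> u theta t <= u theta t'.
  by move=> tt' t'w; rewrite leNgt; apply/negP => ut; apply: nex; exists t, t'.
have := window_mass _ _ _ t0 h0 h2 wE w0; rewrite ltNge => /negP; apply.
set m1 := mu a theta - w; set m2 := mu a theta + w; pose m3 := mu a theta + 3 * w.
have m13 : [/\ m1 < m2, m2 < m3 & m2 - m1 = m3 - m2] by rewrite /m1 /m2 /m3; split; lra.
have [m12 m23 m123] := m13.
apply: (@le_trans _ _ (\int[leb]_(t in `]m2, m3[) (u theta t)%:E)%E).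
  apply: (@integral_itv_le R (u theta) m1 m2 m2 m3 (u theta m2) (measu _) (u0 _) m12 m123).
  - by move=> t /andP[_ tw]; apply: nd; rewrite -/m3 ltW.
  - by move=> t /andP[wt tw]; apply: nd; rewrite -/m3 ltW.
apply: (@le_trans _ _ (\int[leb]_(t in `[m2, +oo[) (u theta t)%:E)%E).
  apply: ge0_subset_integral => //; first exact: measuE.
  - by move=> t _; rewrite lee_fin.
  - by move=> t /=; rewrite !in_itv/= andbT => /andP[/ltW].
apply: (laplace_tail _ (- h) w) => //; rewrite ?normrN ?gtr0_norm// ?oppr_eq0 ?gt_eqF//.
move=> t /=; rewrite in_itv/= andbT => tw; rewrite mulNr -mulrN ler_pM2l//.
by rewrite /m2 in tw; lra.
Qed.

(** Mirror image: the window is compared with the adjacent interval on its left. *)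
Lemma window_high (theta h w : R) : 0 < theta -> 0 < h -> h <= theta / 2 ->
  w = 4 * h * wt2 a theta + 3 / h -> 0 < w ->
  exists t t', [/\ t <= t', mu a theta - 3 * w <= t & u theta t < u theta t'].
Proof.
move=> t0 h0 h2 wE w0; apply: contrapT => nex.
have ni t t' : t <= t' -> mu a theta - 3 * w <= t -> u theta t' <= u theta t.
  by move=> tt' t'w; rewrite leNgt; apply/negP => ut; apply: nex; exists t, t'.
have := window_mass _ _ _ t0 h0 h2 wE w0; rewrite ltNge => /negP; apply.
set m1 := mu a theta - w; set m2 := mu a theta + w; pose m3 := mu a theta - 3 * w.
have m13 : [/\ m1 < m2, m3 < m1 & m2 - m1 = m1 - m3] by rewrite /m1 /m2 /m3; split; lra.
have [m12 m23 m123] := m13.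
apply: (@le_trans _ _ (\int[leb]_(t in `]m3, m1[) (u theta t)%:E)%E).
  apply: (@integral_itv_le R (u theta) m1 m2 m3 m1 (u theta m1) (measu _) (u0 _) m12 m123).
  - by move=> t /andP[wt tw]; apply: ni; rewrite -/m3 ltW.
  - by move=> t /andP[wt tw]; apply: ni; rewrite -/m3 ltW.
apply: (@le_trans _ _ (\int[leb]_(t in `]-oo, m1]) (u theta t)%:E)%E).
  apply: ge0_subset_integral => //; first exact: measuE.
  - by move=> t _; rewrite lee_fin.
  - by move=> t /=; rewrite !in_itv/= => /andP[_ /ltW].
apply: (laplace_tail _ h w) => //; rewrite ?gtr0_norm// ?gt_eqF//.
move=> t /=; rewrite in_itv/= => tw; rewrite ler_pM2l//.
by rewrite /m1 in tw; lra.
Qed.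

End window.

(** * Asymptotics of mu and of the logarithmic derivative *)

Section mu_asymptotics.
Context {R : realType} (a : nat -> R).
Hypothesis a0 : forall i, 0 < a i.
Hypothesis nda : {homo a : i j / (i <= j)%N >-> i <= j}.
Hypothesis cvg_a : cvgn (series (fun i => ((a i) ^+ 2)^-1)).

Let cwt (theta : R) (t0 : 0 < theta) := is_cvg_wt a a0 cvg_a theta t0.
Let cwt2 (theta : R) (t0 : 0 < theta) := is_cvg_wt2 a a0 cvg_a theta t0.

Lemma wt_nonincreasing (al be : R) i : 0 < al -> al <= be -> wt a be i <= wt a al i.
Proof.
move=> al0 albe; have ai := exprn_gt0 2 (a0 i).
by rewrite lef_pV2 ?posrE; lra.
Qed.

Lemma wtB (al be : R) i : 0 < al -> 0 < be ->
  wt a al i - wt a be i = 2 * (be - al) * (wt a al i * wt a be i).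
Proof.
move=> al0 be0; have ai := exprn_gt0 2 (a0 i).
by rewrite /wt; field; apply/andP; split; rewrite gt_eqF//; lra.
Qed.

Lemma mu_sub_ge (al be c : R) (v : nat -> R) : 0 < al -> 0 < be ->
  cvgn (series v) -> (forall i, c * v i <= wt a al i - wt a be i) ->
  c * limn (series v) <= mu a al - mu a be.
Proof.
move=> al0 be0 cv h; rewrite !muE.
rewrite -(lim_seriesB (cwt _ al0) (cwt _ be0)).
have -> : c * limn (series v) = limn (series (c *: v)) by rewrite lim_seriesZ.
apply: lim_series_le => //; first exact: is_cvg_seriesZ.
by apply: is_cvg_seriesB; exact: cwt.
Qed.

Lemma mu_sub_ge_low (al be : R) : 0 < al -> al <= be ->
  2 * (be - al) * wt2 a be <= mu a al - mu a be.
Proof.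
move=> al0 albe; have be0 : 0 < be by apply: lt_le_trans albe.
apply: mu_sub_ge => //; first exact: cwt2.
move=> i; rewrite wtB// ler_wpM2l//; first by lra.
by rewrite expr2 ler_wpM2r ?wt_nonincreasing// wt_ge0.
Qed.

(** Unlike in [mu_sub_ge_low], [wt2] is taken at the smaller argument; this costs the factor
    [al / be], because [theta * wt a theta i] is nondecreasing in [theta]. *)
Lemma mu_sub_ge_high (al be : R) : 0 < al -> al <= be ->
  2 * (be - al) * (al / be) * wt2 a al <= mu a al - mu a be.
Proof.
move=> al0 albe; have be0 : 0 < be by apply: lt_le_trans albe.
apply: mu_sub_ge => //; first exact: cwt2.
move=> i; rewrite wtB// -!mulrA ler_wpM2l// ler_wpM2l//; first by lra.
have ai := exprn_gt0 2 (a0 i).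
rewrite mulrA expr2 mulrCA ler_wpM2l ?wt_ge0//.
rewrite /wt mulrAC -[leRHS]mul1r -ler_pdivlMr ?invr_gt0; last by lra.
rewrite invrK -mulrA ler_pdivrMr; last by lra.
rewrite mul1r -mulrA [leRHS]mulrC ler_pdivlMr; [nra|lra].
Qed.

Lemma mu_sub_le (al be : R) : 0 < al -> al <= be ->
  mu a al - mu a be <= (be - al) / al * mu a al.
Proof.
move=> al0 albe; have be0 : 0 < be by apply: lt_le_trans albe.
rewrite !muE -(lim_seriesB (cwt _ al0) (cwt _ be0)).
have -> : (be - al) / al * limn (series (wt a al)) =
  limn (series (((be - al) / al) *: wt a al)) by rewrite lim_seriesZ//; exact: cwt.
apply: lim_series_le => //.
- by apply: is_cvg_seriesB; exact: cwt.
- by apply: is_cvg_seriesZ; exact: cwt.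
move=> i; change (wt a al i - wt a be i <= (be - al) / al * wt a al i).
rewrite wtB// mulrA mulrAC ler_wpM2r ?wt_ge0//.
have -> : (be - al) / al = 2 * (be - al) * (2 * al)^-1 by field; rewrite gt_eqF.
rewrite ler_wpM2l ?mulr_ge0 ?subr_ge0//.
by apply: le_trans (wt_nonincreasing _ _ _ al0 albe) _; exact: wt_le_theta.
Qed.

Lemma mu_gt0 (theta : R) : 0 < theta -> 0 < mu a theta.
Proof.
move=> t0; rewrite muE; apply: lt_le_trans (wt_gt0 a a0 theta 0 t0) _.
have := nondecreasing_cvgn_le (nondecreasing_series (fun i _ _ => wt_ge0 a a0 theta i t0)) (cwt _ t0) 1%N.
by rewrite /series/= big_nat1.
Qed.

Lemma wt2_gt0 (theta : R) : 0 < theta -> 0 < wt2 a theta.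
Proof.
move=> t0; apply: (@lt_le_trans _ _ (wt a theta 0 ^+ 2)).
  by rewrite exprn_gt0// wt_gt0.
have := nondecreasing_cvgn_le (nondecreasing_series (fun i _ _ => sqr_ge0 (wt a theta i))) (cwt2 _ t0) 1%N.
by rewrite /series/= big_nat1.
Qed.

Lemma mu_decreasing (al be : R) : 0 < al -> al < be -> mu a be < mu a al.
Proof.
move=> al0 albe; rewrite -subr_gt0; apply: lt_le_trans (mu_sub_ge_low _ _ al0 (ltW albe)).
have be0 := lt_trans al0 albe.
by rewrite mulr_gt0 ?wt2_gt0// mulr_gt0// subr_gt0.
Qed.

(** For [theta >= a_n^2] monotonicity of [a] gives [a_i^2 + 2 theta <= 3 theta] for [i < n], so the
    first [n] terms alone contribute at least [n / 9]. *)
Lemma sqr_wt2_unbounded (K : R) : exists2 T : R, 0 < T &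
  forall theta, T <= theta -> K <= theta ^+ 2 * wt2 a theta.
Proof.
pose n := (Num.bound `|9 * K|).+1.
have nK : 9 * K <= n%:R.
  apply: (le_trans (ler_norm _)); rewrite ltW// (lt_le_trans (archi_boundP _))//.
  by rewrite ler_nat.
exists (a n ^+ 2); first by rewrite exprn_gt0.
move=> theta tn; have t0 : 0 < theta by rewrite (lt_le_trans _ tn)// exprn_gt0.
apply: (@le_trans _ _ (theta ^+ 2 * series (fun i => wt a theta i ^+ 2) n)); last first.
  rewrite ler_wpM2l ?sqr_ge0//; apply: nondecreasing_cvgn_le; last exact: cwt2.
  by apply: nondecreasing_series => i _ _; exact: sqr_ge0.
apply: (@le_trans _ _ (theta ^+ 2 * series (fun=> (9 * theta ^+ 2)^-1) n)).
  rewrite /series/= sumr_const_nat subn0 -[X in _ * X]mulr_natl.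
  have -> : theta ^+ 2 * (n%:R * (9 * theta ^+ 2)^-1) = n%:R / 9.
    by field; rewrite gt_eqF.
  by lra.
rewrite ler_wpM2l ?sqr_ge0// /series/= !big_mkord; apply: ler_sum => i _.
have ai := exprn_gt0 2 (a0 i).
have ain : a i ^+ 2 <= a n ^+ 2.
  by rewrite lerXn2r ?nnegrE ?(ltW (a0 _))//; apply: nda; exact: ltnW (ltn_ord i).
have s0 : 0 < a i ^+ 2 + 2 * theta by lra.
rewrite /wt exprVn lef_pV2 ?posrE ?exprn_gt0 ?mulr_gt0 ?exprn_gt0//.
have : (a i ^+ 2 + 2 * theta) <= 3 * theta by lra.
move=> h; apply: (@le_trans _ _ ((3 * theta) ^+ 2)); last by rewrite exprMn; lra.
by rewrite lerXn2r ?nnegrE//; lra.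
Qed.

End mu_asymptotics.

(** * Logarithmic slope of [G] around mu(theta) *)

Section slope.
Context {R : realType} (a : nat -> R) (G : R -> R).
Hypothesis a0 : forall i, 0 < a i.
Hypothesis nda : {homo a : i j / (i <= j)%N >-> i <= j}.
Hypothesis cvg_a : cvgn (series (fun i => ((a i) ^+ 2)^-1)).
Hypothesis ndG : {homo G : x y / x <= y}.
Hypothesis G0 : forall s, 0 <= G s.
Hypothesis lcG : log_concave G.
Hypothesis lapfin : forall theta : R, 0 < theta -> laplace G theta \is a fin_num.
Hypothesis lap0 : forall theta : R, 0 < theta -> (0 < laplace G theta)%E.
Hypothesis lap_shift : forall theta h : R, 0 < theta -> `|h| <= theta / 2 ->
  (laplace G (theta + h)%R <=
   (2 * expR (- h * mu a theta + 4 * h ^+ 2 * wt2 a theta))%:E * laplace G theta)%E.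

Let u (theta t : R) := expR (- (theta * t)) * G t.

Let G_le (k p q : R) : u k q <= u k p -> G q <= G p * expR (k * (q - p)).
Proof.
rewrite /u => h; rewrite -(ler_pM2l (expR_gt0 (- (k * q)))); apply: le_trans h _.
rewrite [leRHS]mulrCA -expRD [leRHS]mulrC.
by have -> : - (k * q) + k * (q - p) = - (k * p) by ring.
Qed.

Let G_ge (k p q : R) : u k p <= u k q -> G p * expR (k * (q - p)) <= G q.
Proof.
rewrite /u => h; rewrite -(ler_pM2l (expR_gt0 (- (k * q)))); apply: le_trans h.
rewrite [leLHS]mulrCA -expRD [leLHS]mulrC.
by have -> : - (k * q) + k * (q - p) = - (k * p) by ring.
Qed.

(** A quasi-concave function that has dropped between [t] and [t'] never increases after [t'];
    undoing the tilt bounds the growth of [G] by the rate [k]. *)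
Lemma slope_after (k t t' : R) : t <= t' -> u k t' < u k t ->
  forall p q, t' <= p -> p <= q -> G q <= G p * expR (k * (q - p)).
Proof.
move=> tt' ut p q tp pq; apply: G_le.
have h1 : minr (u k t) (u k q) <= u k t'.
  by apply: log_concave_tilt => //; rewrite tt' (le_trans tp).
have h2 : minr (u k t) (u k q) <= u k p.
  by apply: log_concave_tilt => //; rewrite pq andbT (le_trans tt').
move: h1 h2; rewrite !ge_min (leNgt (u k t) (u k t')) ut/= => h1.
move=> /orP[h2|//]; apply: le_trans h2; apply: (le_trans h1).
exact: ltW.
Qed.

(** Dually, a quasi-concave function that rises between [t] and [t'] is nondecreasing up to [t]. *)
Lemma slope_before (k t t' : R) : t <= t' -> u k t < u k t' ->
  forall p q, p <= q -> q <= t -> G p * expR (k * (q - p)) <= G q.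
Proof.
move=> tt' ut p q pq qt; apply: G_ge.
have h1 : minr (u k p) (u k t') <= u k t.
  by apply: log_concave_tilt => //; rewrite tt' (le_trans pq).
have h2 : minr (u k p) (u k t') <= u k q.
  by apply: log_concave_tilt => //; rewrite pq (le_trans qt).
move: h1 h2; rewrite !ge_min (leNgt (u k t') (u k t)) ut orbF => h1.
move=> /orP[//|h2]; apply: le_trans h2; apply: (le_trans h1).
exact: ltW.
Qed.

(** The window at [(1 + de) * theta] ends left of the interval and gives the upper slope; the one at
    [(1 - de) * theta] starts right of it and gives the lower slope. The last clause records that
    [G] is already positive to the left. *)
Lemma slope_near_mu (de K : R) : 0 < de -> de <= 2^-1 -> 0 <= K ->
  exists2 T : R, 0 < T & forall theta, T <= theta ->
  (forall p q, mu a theta - K / theta <= p -> p <= q ->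
     G q <= G p * expR ((1 + de) * theta * (q - p))) /\
  (forall p q, p <= q -> q <= mu a theta + K / theta ->
     G p * expR ((1 - de) * theta * (q - p)) <= G q) /\
  (exists t t', [/\ t <= t', t' <= mu a theta - K / theta & 0 < G t]).
Proof.
move=> de0 de2 K0.
(* Even after division by 4 this bound leaves room for [216 / de] from the windows and for [K]; the
   4 pays for [((1 + de) * theta)^2 <= 4 * theta^2]. *)
have [T T0 hT] := sqr_wt2_unbounded a a0 nda cvg_a ((1000 / de + 4 * K) / de).
have hT' theta : T <= theta -> 1000 / de + 4 * K <= de * (theta ^+ 2 * wt2 a theta).
  by move=> Tt; rewrite [leRHS]mulrC -ler_pdivrMr//; exact: hT.
(* Doubling ensures [(1 - de) * theta >= T], as [de <= 1/2]. *)
exists (2 * T); first by lra.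
move=> theta Tt; have t0 : 0 < theta by lra.
(* With h = de / 24 * be, three half-widths amount to de / 2 * be * V up to
   O(1 / theta), whereas the mu-values to be separated are about
   2 * de * theta * V apart. *)
have window be : T <= be -> exists h w : R, [/\ 0 < h, h <= be / 2,
    w = 4 * h * wt2 a be + 3 / h, 0 < w &
    3 * w = de / 2 * be * wt2 a be + 216 / (de * be)].
  move=> Tbe; have be0 : 0 < be by lra.
  have V0 := wt2_gt0 a a0 cvg_a be be0.
  pose h := de / 24 * be.
  have h0 : 0 < h by rewrite /h mulr_gt0// divr_gt0.
  exists h, (4 * h * wt2 a be + 3 / h); split=> //.
  - by rewrite /h; nra.
  - by rewrite addr_gt0// ?divr_gt0// mulr_gt0// mulr_gt0.
  - by rewrite /h; field; rewrite !gt_eqF.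
have low : exists t t', [/\ t <= t', t' <= mu a theta - K / theta &
    u ((1 + de) * theta) t' < u ((1 + de) * theta) t].
  set be := (1 + de) * theta.
  have Tbe : T <= be by rewrite /be; nra.
  have [h [w [h0 h2 wE w0 w3]]] := window _ Tbe.
  have be0 : 0 < be by lra.
  have [t [t' [tt' t'w ut]]] := window_low a G ndG G0 lapfin lap0 lap_shift be h w be0 h0 h2 wE w0.
  exists t, t'; split => //; apply: (le_trans t'w).
  have tbe : theta <= be by rewrite /be; nra.
  have := mu_sub_ge_low a a0 cvg_a theta be t0 tbe.
  have V0 := wt2_gt0 a a0 cvg_a be be0.
  have := hT' _ Tbe; rewrite w3.
  set V := wt2 a be in V0 *; set m := mu a theta; set m' := mu a be => hV hm.
  suff : de / 2 * be * V + 216 / (de * be) + K / theta <= 2 * (be - theta) * V by lra.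
  have split3 (x y z c : R) : (x + y + z) * c = x * c + y * c + z * c by ring.
  (* After multiplication by [theta], one copy of [de * theta^2 * V] on the right absorbs the first
     term and the other absorbs [216 / de + K]. *)
  rewrite -(ler_pM2r t0) split3.
  have -> : K / theta * theta = K by rewrite mulfVK// gt_eqF.
  have h3 : 216 / (de * be) * theta <= 216 / de.
    rewrite invfM mulrA -[leRHS]mulr1 -mulrA ler_wpM2l ?divr_ge0 ?(ltW de0)//.
    by rewrite mulrC ler_pdivrMr ?mul1r.
  have h4 : de / 2 * be * V * theta <= de * theta ^+ 2 * V.
    have : 0 <= de * theta * V * theta * (1 - de) by rewrite !mulr_ge0 ?ltW//; lra.
    by rewrite /be; lra.
  have h5 : 2 * (be - theta) * V * theta = 2 * de * theta ^+ 2 * V by rewrite /be; ring.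
  have h6 : de * (be ^+ 2 * V) <= 4 * (de * theta ^+ 2 * V).
    have -> : de * (be ^+ 2 * V) = (1 + de) ^+ 2 * (de * theta ^+ 2 * V) by rewrite /be; ring.
    rewrite ler_wpM2r ?mulr_ge0 ?ltW ?exprn_gt0//; nra.
  have h9 : 0 < de^-1 by rewrite invr_gt0.
  rewrite h5; lra.
have high : exists t t', [/\ t <= t', mu a theta + K / theta <= t &
    u ((1 - de) * theta) t < u ((1 - de) * theta) t'].
  set be := (1 - de) * theta.
  have Tbe : T <= be by rewrite /be; nra.
  have [h [w [h0 h2 wE w0 w3]]] := window _ Tbe.
  have be0 : 0 < be by lra.
  have [t [t' [tt' t'w ut]]] := window_high a G ndG G0 lapfin lap0 lap_shift be h w be0 h0 h2 wE w0.
  exists t, t'; split => //; apply: le_trans t'w.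
  have tbe : be <= theta by rewrite /be; nra.
  have := mu_sub_ge_high a a0 cvg_a be theta be0 tbe.
  have V0 := wt2_gt0 a a0 cvg_a be be0.
  have := hT' _ Tbe; rewrite w3.
  set V := wt2 a be in V0 *; set m := mu a theta; set m' := mu a be => hV hm.
  suff : de / 2 * be * V + 216 / (de * be) + K / theta <= 2 * (theta - be) * (be / theta) * V by lra.
  have -> : 2 * (theta - be) * (be / theta) * V = 2 * de * be * V.
    by rewrite /be; field; rewrite gt_eqF.
  have split3 (x y z c : R) : (x + y + z) * c = x * c + y * c + z * c by ring.
  rewrite -(ler_pM2r be0) split3.
  have hK : K / theta * be <= K.
    by rewrite -mulrA -[leRHS]mulr1 ler_wpM2l// mulrC ler_pdivrMr ?mul1r.
  have h3 : 216 / (de * be) * be = 216 / de by field; rewrite !gt_eqF.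
  have h9 : 0 < de^-1 by rewrite invr_gt0.
  have h10 : 2 * de * be * V * be = 2 * (de * (be ^+ 2 * V)) by ring.
  have h11 : de / 2 * be * V * be = 2^-1 * (de * (be ^+ 2 * V)) by ring.
  rewrite h3 h10 h11; lra.
have [t [t' [tt' t'm ut]]] := low; have [r [r' [rr' rm ur]]] := high.
split; last split.
- by move=> p q pm pq; apply: (slope_after _ t t') => //; apply: le_trans pm.
- by move=> p q pq qm; apply: (slope_before _ r r') => //; apply: le_trans rm.
- exists t, t'; split => //; rewrite lt_neqAle G0 andbT eq_sym; apply/eqP => Gt.
  by move: ut; rewrite /u Gt mulr0 ltNge mulr_ge0// expR_ge0.
Qed.

End slope.

(** * The inverse of mu and consequences of the slope bounds *)

Section mu_inverse.
Context {R : realType} (a : nat -> R).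
Hypothesis a0 : forall i, 0 < a i.
Hypothesis cvg_a : cvgn (series (fun i => ((a i) ^+ 2)^-1)).

Lemma mu_lt_mono (al be : R) : 0 < al -> 0 < be -> (mu a be < mu a al) = (al < be).
Proof.
move=> al0 be0; apply/idP/idP => [h|albe]; last exact: mu_decreasing.
rewrite ltNge; apply/negP; rewrite le_eqVlt => /orP[/eqP e|beal].
  by move: h; rewrite e ltxx.
by have := mu_decreasing a a0 cvg_a _ _ be0 beal; rewrite ltNge ltW.
Qed.

Lemma mu_le_mono (al be : R) : 0 < al -> 0 < be -> (mu a be <= mu a al) = (al <= be).
Proof. by move=> al0 be0; rewrite !leNgt mu_lt_mono. Qed.

(** The terms beyond some [n] sum to at most [e / 2] uniformly in [theta], by comparison with
    [1 / a_i^2]; the first [n] are each at most [1 / (2 theta)]. *)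
Lemma mu_eventually_le (e : R) : 0 < e -> exists2 T : R, 0 < T &
  forall theta, T <= theta -> mu a theta <= e.
Proof.
move=> e0; set S := fun i => (a i ^+ 2)^-1.
have S0 i : 0 <= S i by rewrite /S invr_ge0 exprn_ge0// ltW.
have e20 : 0 < e / 2 by rewrite divr_gt0.
move/cvgrPdist_le : (cvg_a) => /(_ _ e20)[n _ hn].
have ndS : nondecreasing_seq (series S) by apply: nondecreasing_series => i _ _.
(* For [theta >= n / e] the first [n] terms total at most [e / 2]; the added 1 keeps [T] positive
   when [n = 0]. *)
pose T := n%:R / e + 1.
have T0 : 0 < T by rewrite /T ltr_wpDl// divr_ge0// ltW.
exists T => // theta Tt; have t0 : 0 < theta := lt_le_trans T0 Tt.
rewrite muE; apply: limr_le; first exact: is_cvg_wt.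
near=> m.
have nm : (n <= m)%N by near: m; exists n.
have : series (wt a theta) m - series (wt a theta) n <= series S m - series S n.
  rewrite !sub_series_geq//; apply: ler_sum => i _; exact: wt_le.
have h1 : series (wt a theta) n <= n%:R / (2 * theta).
  rewrite /series/= big_mkord mulr_natl -[X in _ *+ X]card_ord -sumr_const.
  by apply: ler_sum => i _; exact: wt_le_theta.
have h2 : series S m - series S n <= e / 2.
  apply: le_trans (hn n (leqnn n)); apply: le_trans (ler_norm _).
  rewrite lerD2r; exact: nondecreasing_cvgn_le.
have h3 : n%:R / (2 * theta) <= e / 2.
  rewrite ler_pdivrMr ?mulr_gt0//.
  have -> : e / 2 * (2 * theta) = theta * e by field.
  have : n%:R / e <= theta by apply: le_trans Tt; rewrite /T; lra.
  by rewrite ler_pdivrMr.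
lra.
Unshelve. all: by end_near. Qed.

(** By [mu_sub_le], [mu] is Lipschitz on the half-line from [theta / 2] on. *)
Lemma mu_continuous (theta : R) : 0 < theta -> {for theta, continuous (mu a)}.
Proof.
move=> t0; apply/cvgrPdist_le => e e0.
have t20 : 0 < theta / 2 by rewrite divr_gt0.
set M := mu a (theta / 2).
have M0 : 0 < M by exact: mu_gt0.
have key (al be : R) : theta / 2 <= al -> al <= be ->
    0 <= mu a al - mu a be <= (be - al) * (2 / theta * M).
  move=> tal albe; have al0 : 0 < al by lra.
  have be0 : 0 < be by lra.
  rewrite subr_ge0 mu_le_mono// albe/=.
  apply: le_trans (mu_sub_le a a0 cvg_a _ _ al0 albe) _.
  rewrite -mulrA ler_wpM2l ?subr_ge0//.
  rewrite ler_pM ?invr_ge0 ?(ltW al0) ?(ltW (mu_gt0 a a0 cvg_a _ al0))//.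
    by rewrite -[2 / theta]invf_div lef_pV2 ?posrE.
  by rewrite mu_le_mono.
have c0 : 0 < 2 / theta * M by rewrite mulr_gt0// divr_gt0.
near=> y.
have y2 : `|theta - y| <= theta / 2 by near: y; apply: cvgr_dist_le.
have ye : `|theta - y| <= e / (2 / theta * M).
  by near: y; apply: cvgr_dist_le => //; rewrite divr_gt0.
have ty : theta / 2 <= y by move: y2; rewrite ler_norml => /andP[]; lra.
have tt : theta / 2 <= theta by lra.
have [yt|ty'] := leP y theta.
  have /andP[h1 h2] := key y theta ty yt.
  rewrite distrC ger0_norm//; apply: (le_trans h2).
  rewrite -ler_pdivlMr//; apply: le_trans ye; exact: ler_norm.
have /andP[h1 h2] := key theta y tt (ltW ty').
rewrite ger0_norm//; apply: (le_trans h2).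
rewrite -ler_pdivlMr//; apply: le_trans ye; rewrite distrC; exact: ler_norm.
Unshelve. all: by end_near. Qed.

Lemma mu_surjective (s : R) : 0 < s -> s <= mu a 1 ->
  exists2 theta : R, 1 <= theta & mu a theta = s.
Proof.
move=> s0 s1; have [T T0 hT] := mu_eventually_le _ s0.
pose T' := maxr T 1.
have T'1 : 1 <= T' by rewrite le_max lexx orbT.
have T's : mu a T' <= s by apply: hT; rewrite le_max lexx.
have cmu : {within `[1, T'], continuous (mu a)}.
  apply: continuous_in_subspaceT => x; rewrite inE/= in_itv/= => /andP[x1 _].
  by apply: mu_continuous; apply: lt_le_trans x1.
have [|theta] := @IVT _ _ _ _ s T'1 cmu.
  by rewrite ge_min le_max T's s1 orbT.
by rewrite in_itv/= => /andP[t1 _] ts; exists theta.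
Qed.

(** For [s] up to [mu a 1] the equation defining [mu_inv] has a solution, so the default 0 of [xget]
    is not returned; monotonicity puts the solution at 1 or above. *)
Lemma mu_invP (s : R) : 0 < s -> s <= mu a 1 -> 1 <= mu_inv a s /\ mu a (mu_inv a s) = s.
Proof.
move=> s0 s1; have [theta t1 ts] := mu_surjective s s0 s1.
have ex : exists t, [set theta | 0 < theta /\ mu a theta = s] t.
  by exists theta; split => //; apply: lt_le_trans t1.
rewrite /mu_inv; have [t0 te] := xgetPex 0 ex; split => //.
by rewrite -mu_le_mono// te.
Qed.

Lemma mu_inv_mu (theta : R) : 1 <= theta -> mu_inv a (mu a theta) = theta.
Proof.
move=> t1; have t0 : 0 < theta by apply: lt_le_trans t1.
have m1 : mu a theta <= mu a 1 by rewrite mu_le_mono.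
have [i1 ie] := mu_invP _ (mu_gt0 a a0 cvg_a _ t0) m1.
have i0 : 0 < mu_inv a (mu a theta) by apply: lt_le_trans i1.
by apply/eqP; rewrite eq_le -(mu_le_mono _ _ i0 t0) -(mu_le_mono _ _ t0 i0) ie lexx.
Qed.

(** Both [mu] and inversion reverse the order; the point 0 is treated apart, every other value being
    positive. *)
Lemma rho_aux_mono : {in `[0, mu a 1] &, {mono rho_aux a : x y / x <= y}}.
Proof.
have rho0 : rho_aux a 0 = 0 by rewrite /rho_aux ltxx.
have rhogt x : 0 < x -> x <= mu a 1 -> 0 < rho_aux a x.
  move=> x0 x1; rewrite /rho_aux x0 invr_gt0.
  by have [i1 _] := mu_invP _ x0 x1; apply: lt_le_trans i1.
move=> x y; rewrite !in_itv/= => /andP[x0 x1] /andP[y0 y1].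
have [xe|xn] := eqVneq x 0.
  rewrite xe y0 rho0; have [->|yn] := eqVneq y 0; first by rewrite rho0 lexx.
  by rewrite ltW// rhogt// lt_neqAle eq_sym yn.
have xp : 0 < x by rewrite lt_neqAle eq_sym xn.
have [ye|yn] := eqVneq y 0.
  by rewrite ye rho0 !leNgt rhogt// xp.
have yp : 0 < y by rewrite lt_neqAle eq_sym yn.
rewrite /rho_aux xp yp.
have [ix1 ixe] := mu_invP _ xp x1; have [iy1 iye] := mu_invP _ yp y1.
have ix0 := lt_le_trans ltr01 ix1; have iy0 := lt_le_trans ltr01 iy1.
by rewrite lef_pV2 ?posrE// -(mu_le_mono _ _ iy0 ix0) ixe iye.
Qed.

(** A strictly increasing map of [0, mu(1)] onto [0, 1] is continuous, which covers the endpoint 0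
    as well; the preimage of [r > 0] is [mu a r^-1]. *)
Lemma rho_aux_continuous : {within `[0, mu a 1], continuous (rho_aux a)}.
Proof.
apply: segment_inc_surj_continuous; first exact: rho_aux_mono.
have m1 := mu_gt0 a a0 cvg_a 1 ltr01.
have rho0 : rho_aux a 0 = 0 by rewrite /rho_aux ltxx.
have rho1 : rho_aux a (mu a 1) = 1 by rewrite /rho_aux m1 mu_inv_mu// invr1.
rewrite rho0 rho1 => r /=; rewrite in_itv/= => /andP[r0 r1].
have [->|rn] := eqVneq r 0.
  by exists 0 => //; rewrite /= in_itv/= lexx ltW.
have rp : 0 < r by rewrite lt_neqAle eq_sym rn.
have ri1 : 1 <= r^-1 by rewrite invf_ge1.
have ri0 : 0 < r^-1 by rewrite invr_gt0.
have mr0 := mu_gt0 a a0 cvg_a _ ri0.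
exists (mu a r^-1); first by rewrite /= in_itv/= ltW//= mu_le_mono.
by rewrite /rho_aux mr0 mu_inv_mu// invrK.
Qed.

End mu_inverse.

(** * Consequences of the slope bounds for [G] *)

Section limit_law.
Context {R : realType} (a : nat -> R) (G : R -> R).
Hypothesis a0 : forall i, 0 < a i.
Hypothesis cvg_a : cvgn (series (fun i => ((a i) ^+ 2)^-1)).
Hypothesis ndG : {homo G : x y / x <= y}.
Hypothesis G01 : forall s, 0 <= G s <= 1.
Hypothesis slopeG : forall de K : R, 0 < de -> de <= 2^-1 -> 0 <= K ->
  exists2 T : R, 0 < T & forall theta, T <= theta ->
  (forall p q, mu a theta - K / theta <= p -> p <= q ->
     G q <= G p * expR ((1 + de) * theta * (q - p))) /\
  (forall p q, p <= q -> q <= mu a theta + K / theta ->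
     G p * expR ((1 - de) * theta * (q - p)) <= G q) /\
  (exists t t', [/\ t <= t', t' <= mu a theta - K / theta & 0 < G t]).

Lemma small_mu (s T : R) : 0 < s -> exists theta : R, [/\ 0 < theta, T <= theta & mu a theta <= s].
Proof.
move=> s0; have [T' T'0 hT'] := mu_eventually_le a a0 cvg_a _ s0.
exists (maxr T T'); rewrite lt_max T'0 orbT le_max lexx; split => //.
by apply: hT'; rewrite le_max lexx orbT.
Qed.

(** The slope bounds provide a point of positivity below [mu a theta], and [mu] tends to 0. *)
Lemma limit_gt0 (s : R) : 0 < s -> 0 < G s.
Proof.
move=> s0; have h : (0 : R) < 2^-1 by rewrite invr_gt0.
have [T T0 hT] := slopeG _ 0 h (lexx _) (lexx _).
have [theta [t0 Tt ms]] := small_mu s T s0.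
have [_ [_ [t [t' [tt']]]]] := hT _ Tt.
rewrite mul0r subr0 => t'm Gt; apply: lt_le_trans Gt _; apply: ndG.
exact: le_trans (le_trans tt' t'm) ms.
Qed.

Lemma limit_slope (s : R) : 0 < s -> exists k : R,
  forall p q, s <= p -> p <= q -> G q <= G p * expR (k * (q - p)).
Proof.
move=> s0; have h : (0 : R) < 2^-1 by rewrite invr_gt0.
have [T T0 hT] := slopeG _ 0 h (lexx _) (lexx _).
have [theta [t0 Tt ms]] := small_mu s T s0.
have [up _] := hT _ Tt.
exists ((1 + 2^-1) * theta) => p q sp pq; apply: up => //.
by rewrite mul0r subr0; apply: le_trans sp.
Qed.

(** Growth at rate at least [T / 2] over the length [K / T] after [mu a T], while [G] stays at most
    1, forces [G (mu a T) <= exp (- K / 2)]. *)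
Lemma limit_vanish (e : R) : 0 < e -> exists2 s : R, 0 < s & G s <= e.
Proof.
move=> e0; have h : (0 : R) < 2^-1 by rewrite invr_gt0.
(* This [K] makes the bound [exp (- 1 / e)], which is at most [e] because [exp (1 / e) >= 1 / e]. *)
pose K := 2 * e^-1.
have K0 : 0 <= K by rewrite /K mulr_ge0// invr_ge0 ltW.
have [T T0 hT] := slopeG _ K h (lexx _) K0.
have [_ [low _]] := hT _ (lexx T).
exists (mu a T); first exact: mu_gt0.
have KT : 0 <= K / T by rewrite divr_ge0// ltW.
have := low (mu a T) (mu a T + K / T); rewrite lerDl KT lexx => /(_ isT isT).
have -> : (1 - 2^-1) * T * (mu a T + K / T - mu a T) = e^-1.
  by rewrite /K; field; rewrite !gt_eqF.
have /andP[_ G1] := G01 (mu a T + K / T).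
move=> /le_trans /(_ G1); rewrite -ler_pdivlMr ?expR_gt0// mul1r => /le_trans; apply.
rewrite -[leRHS]invrK lef_pV2 ?posrE ?expR_gt0 ?invr_gt0//.
by apply: le_trans (expR_ge1Dx _); rewrite lerDr.
Qed.

(** With [s = mu a theta] the shift is [x / theta], so the slope bounds for [K = |x|] enclose the
    ratio between [exp (x - de |x|)] and [exp (x + de |x|)]. *)
Lemma limit_ratio (x : R) :
  (fun s => G (s + x * rho_aux a s) / G s) @ 0^'+ --> expR x.
Proof.
apply/cvgrPdist_lt => e e0.
have : \forall y \near x, `|expR x - expR y| < e.
  by have /cvgrPdist_lt := @continuous_expR R x; apply.
move=> /nbhs_ballP[eta /= eta0 heta].
(* This makes [de * |x| < eta]; the added 1 covers [x = 0]. *)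
pose de := minr 2^-1 (eta / (2 * (`|x| + 1))).
have x10 : 0 < `|x| + 1 by rewrite ltr_wpDl.
have de0 : 0 < de.
  by rewrite lt_min invr_gt0 ltr0n/= divr_gt0// mulr_gt0.
have de2 : de <= 2^-1 by rewrite ge_min lexx.
have dex : de * `|x| < eta.
  have : de <= eta / (2 * (`|x| + 1)) by rewrite ge_min lexx orbT.
  rewrite ler_pdivlMr ?mulr_gt0// => h.
  have := normr_ge0 x; nra.
have [T T0 hT] := slopeG _ `|x| de0 de2 (normr_ge0 x).
near=> s.
have s0 : 0 < s by near: s; exact: nbhs_right_gt.
have s1 : s <= mu a 1.
  by near: s; apply: nbhs_right_le; exact: mu_gt0.
have sT : s <= mu a T.
  by near: s; apply: nbhs_right_le; exact: mu_gt0.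
have [i1 ie] := mu_invP a a0 cvg_a s s0 s1.
rewrite /rho_aux s0; set theta := mu_inv a s in i1 ie *.
have t0 : 0 < theta by apply: lt_le_trans i1.
have Tt : T <= theta by rewrite -(mu_le_mono a a0 cvg_a)// ie.
have [up [low _]] := hT _ Tt; rewrite ie in up low.
have Gs := limit_gt0 s s0.
have xt0 : 0 <= `|x| / theta by rewrite divr_ge0// ltW.
have [r1 r2] : expR (x - de * `|x|) <= G (s + x / theta) / G s /\
   G (s + x / theta) / G s <= expR (x + de * `|x|).
  have [x0|x0] := leP 0 x.
    have xn : `|x| = x by rewrite ger0_norm.
    rewrite xn in up low xt0 *; split.
      rewrite ler_pdivlMr// [leLHS]mulrC.
      have -> : x - de * x = (1 - de) * theta * (s + x / theta - s).
        by field; rewrite gt_eqF.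
      by apply: low; rewrite ?lerDl.
    rewrite ler_pdivrMr// [leRHS]mulrC.
    have -> : x + de * x = (1 + de) * theta * (s + x / theta - s).
      by field; rewrite gt_eqF.
    by apply: up; rewrite ?lerDl// gerBl.
  (* For negative [x] the slope bounds run from [s + x / theta] up to [s], so the upper bound on the
     slope gives the lower bound on the ratio and conversely. *)
  have xn : `|x| = - x by rewrite ltr0_norm.
  rewrite xn in up low xt0 *.
  have sx : s + x / theta <= s by rewrite gerDl; lra.
  split.
    rewrite ler_pdivlMr// [leLHS]mulrC -ler_pdivlMr ?expR_gt0// -expRN.
    have -> : - (x - de * - x) = (1 + de) * theta * (s - (s + x / theta)).
      by field; rewrite gt_eqF.
    by apply: up => //; rewrite mulNr opprK.
  rewrite ler_pdivrMr// [leRHS]mulrC -ler_pdivrMr ?expR_gt0// -expRN.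
  have -> : - (x + de * - x) = (1 - de) * theta * (s - (s + x / theta)).
    by field; rewrite gt_eqF.
  by apply: low => //; rewrite lerDl.
have b1 : `|expR x - expR (x - de * `|x|)| < e.
  by apply: heta; rewrite /ball/= opprB addrC subrK ger0_norm// mulr_ge0// ltW.
have b2 : `|expR x - expR (x + de * `|x|)| < e.
  by apply: heta; rewrite /ball/= opprD addrA subrr sub0r normrN ger0_norm// mulr_ge0// ltW.
move: b1 b2; rewrite !ltr_norml => /andP[_ b1] /andP[b2 _].
by apply/andP; split; lra.
Unshelve. all: by end_near. Qed.

(** At 0 this follows from [limit_vanish], at positive points from the exponential growth bound. *)
Lemma limit_right_continuous (s : R) : (forall t, t <= 0 -> G t = 0) ->
  G @ s^'+ --> G s.
Proof.
move=> GN; apply/cvgrPdist_le => e e0.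
have [s0|s0] := ltP s 0.
  near=> t; have t0 : t < 0 by near: t; exact: nbhs_right_lt.
  by rewrite (GN s (ltW s0)) (GN t (ltW t0)) subrr normr0 ltW.
move: s0; rewrite le_eqVlt => /orP[/eqP s0|s0].
  rewrite -s0 GN//; have [u u0 Gu] := limit_vanish e e0.
  near=> t; rewrite sub0r normrN ger0_norm ?(andP (G01 t)).1//.
  apply: le_trans Gu; apply: ndG; near: t; exact: nbhs_right_le.
have [k hk] := limit_slope s s0.
have cE : expR (k * (t - s)) @[t --> s^'+] --> (1 : R).
  rewrite -[X in _ --> X]expR0 -(mulr0 k) -(subrr s).
  apply: cvg_at_right_filter; apply: continuous_cvg; first exact: continuous_expR.
  by apply: cvgM; [exact: cvg_cst|apply: cvgB; [exact: cvg_id|exact: cvg_cst]].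
near=> t.
have st : s < t by near: t; exact: nbhs_right_gt.
rewrite distrC ger0_norm ?subr_ge0; last by apply: ndG; exact: ltW.
have h1 := hk s t (lexx s) (ltW st).
have h2 : `|1 - expR (k * (t - s))| <= e by near: t; apply: cvgr_dist_le cE _ e0.
have /andP[h3 h4] := G01 s.
move: h2; rewrite ler_norml => /andP[h2 _]; nra.
Unshelve. all: by end_near. Qed.

(** Left continuity in the form of an upper bound: [G s <= G t * exp (k (s - t)) <= y * exp (k (s -
    t))], and [t] tends to [s]. *)
Lemma limit_le_of_left (s y : R) : 0 < s -> (forall t, t < s -> G t <= y) -> G s <= y.
Proof.
move=> s0 hy; have s20 : 0 < s / 2 by rewrite divr_gt0.
have s2s : s / 2 < s by lra.
have y0 : 0 <= y by apply: le_trans (hy _ s2s); have /andP[] := G01 (s / 2).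
have [k hk] := limit_slope _ s20.
have cE : y * expR (k * (s - t)) @[t --> s^'-] --> y.
  rewrite -[X in _ --> X]mulr1 -expR0 -(mulr0 k) -(subrr s).
  apply: cvg_at_left_filter; apply: cvgM; first exact: cvg_cst.
  apply: continuous_cvg; first exact: continuous_expR.
  by apply: cvgM; [exact: cvg_cst|apply: cvgB; [exact: cvg_cst|exact: cvg_id]].
apply: (cvgr_to_ge cE); near=> t.
have ts : t < s by near: t; exact: nbhs_left_lt.
have st : s / 2 <= t by near: t; exact: nbhs_left_ge.
apply: le_trans (hk t s st (ltW ts)) _.
by rewrite ler_wpM2r ?expR_ge0// hy.
Unshelve. all: by end_near. Qed.

End limit_law.

(** * The limit law *)

Lemma log_concave_heaviside {R : realType} :
  log_concave (fun s : R => (0 < s)%R%:R).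
Proof.
move=> al be u v l /andP[l0 l1].
have [u0|u0] := ltP 0 u; last by rewrite ge_min mulr0 mulr_ge0 ?expR_ge0.
have [v0|v0] := ltP 0 v; last by rewrite ge_min mulr0 mulr_ge0 ?expR_ge0 ?orbT.
have -> : 0 < l * u + (1 - l) * v by nra.
rewrite !mulr1 ge_min !ler_expR.
have [ab|ba] := leP al be; [apply/orP; left|apply/orP; right]; nra.
Qed.

(** * Convergence of the partial distribution functions *)

Section partial_cdf_properties.
Context {R : realType} {d : measure_display} {T : measurableType d}
  (P : probability T R) (X : nat -> T -> R) (a : nat -> R).
Hypothesis iidX : iid_std_normal P X.
Hypothesis a0 : forall i, 0 < a i.
Hypothesis nda : {homo a : i j / (i <= j)%N >-> i <= j}.
Hypothesis cvg_a : cvgn (series (fun i => ((a i) ^+ 2)^-1)).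

Let S := partial_zsum a X.
Let Gn := partial_cdf P a X.

Lemma partial_zsum_ge0 n w : 0 <= S n w.
Proof. by apply: sumr_ge0 => i _; rewrite divr_ge0 ?sqr_ge0. Qed.

Lemma partial_zsum_homo w : {homo S^~ w : m n / (m <= n)%N >-> m <= n}.
Proof.
apply: homo_leq => [x//|y x z|n]; first exact: le_trans.
by rewrite /S /partial_zsum big_ord_recr /= lerDl divr_ge0 ?sqr_ge0.
Qed.

Lemma measurable_partial_zsum_lt n s : measurable [set w | S n w < s].
Proof.
have : measurable_fun setT (fun w => S n w < s).
  by apply: measurable_fun_ltr => //; exact: (measurable_partial_zsum P).
by move=> /(_ measurableT [set true]); rewrite setTI; exact.
Qed.

Lemma zsumE w : zsum a X w = limn (fun n => (S n w)%:E).
Proof.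
rewrite /zsum; congr (lim _); congr (_ @ \oo); apply/funext => n.
by rewrite sumEFin big_mkord.
Qed.

Lemma partial_zsum_le n w : ((S n w)%:E <= zsum a X w)%E.
Proof.
rewrite /S /partial_zsum -(big_mkord xpredT (fun i => X i w ^+ 2 / a i ^+ 2)) -sumEFin.
by apply: nneseries_lim_ge => i _ _; rewrite lee_fin divr_ge0 ?sqr_ge0.
Qed.

Lemma zsum_le w (s : R) : (forall n, S n w <= s) -> (zsum a X w <= s%:E)%E.
Proof.
move=> h; rewrite zsumE; apply: lime_le; last by near=> n; rewrite lee_fin.
apply: ereal_nondecreasing_is_cvgn => m n mn; rewrite lee_fin.
exact: partial_zsum_homo.
Unshelve. all: by end_near. Qed.

Lemma measurable_zsum_lt (s : R) : measurable [set w | (zsum a X w < s%:E)%E].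
Proof.
have mz : measurable_fun setT (zsum a X).
  rewrite /zsum; apply: ge0_emeasurable_sum => [k w _ _|k _].
    by rewrite lee_fin divr_ge0 ?sqr_ge0.
  apply/measurable_EFinP; apply: measurable_funM => //; apply: measurable_funX.
  by case: iidX.
rewrite (_ : mkset _ = setT `&` zsum a X @^-1` `]-oo, s%:E[%classic).
  by apply: mz => //; exact: emeasurable_itv.
by rewrite setTI; apply/seteqP; split => w /=; rewrite in_itv.
Qed.

Lemma partial_cdf01 n s : 0 <= Gn n s <= 1.
Proof.
rewrite fine_ge0 ?measure_ge0//= -lee_fin fineK.
  by apply: probability_le1; exact: measurable_partial_zsum_lt.
by rewrite fin_num_measure//; exact: measurable_partial_zsum_lt.
Qed.

Lemma partial_cdf_homo n : {homo Gn n : x y / x <= y}.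
Proof.
move=> x y xy; rewrite /Gn /partial_cdf fine_le ?fin_num_measure//;
  try exact: measurable_partial_zsum_lt.
rewrite le_measure ?inE//; try exact: measurable_partial_zsum_lt.
by move=> w /= /lt_le_trans; exact.
Qed.

Lemma partial_cdf_nonincreasing s : {homo Gn^~ s : m n / (m <= n)%N >-> n <= m}.
Proof.
move=> m n mn; rewrite /Gn /partial_cdf fine_le ?fin_num_measure//;
  try exact: measurable_partial_zsum_lt.
rewrite le_measure ?inE//; try exact: measurable_partial_zsum_lt.
by move=> w /=; apply: le_lt_trans; exact: partial_zsum_homo.
Qed.

Lemma partial_cdf_nonpos n s : s <= 0 -> Gn n s = 0.
Proof.
move=> s0; rewrite /Gn /partial_cdf (_ : mkset _ = set0) ?measure0//.
apply/seteqP; split => // w /= /lt_le_trans /(_ s0).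
by rewrite ltNge partial_zsum_ge0.
Qed.

Lemma partial_cdf0 s : Gn 0 s = (0 < s)%R%:R.
Proof.
have [s0|s0] := ltP 0 s; last exact: partial_cdf_nonpos.
rewrite /Gn /partial_cdf (_ : mkset _ = setT) ?probability_setT//.
by apply/seteqP; split => // w _ /=; rewrite /partial_zsum big_ord0.
Qed.

Lemma partial_cdf_log_concave n : log_concave (Gn n).
Proof.
elim: n => [|n IH].
  have -> : Gn 0%N = (fun s => (0 < s)%R%:R) by apply/funext => s; exact: partial_cdf0.
  exact: log_concave_heaviside.
apply: (@log_concave_gaussian_convolution _ (Gn n) _ (a n ^+ 2)^-1) => //.
- exact: partial_cdf_homo.
- by move=> s; have /andP[] := partial_cdf01 n s.
- by rewrite invr_ge0 sqr_ge0.
- by move=> s; exact: partial_cdf_recursion.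
Qed.

(** The events [S n w < s] decrease with [n], so this is the probability of their intersection, an
    event between [z < s] and [z <= s]. *)
Definition limit_cdf (s : R) : R := limn (Gn^~ s).

Lemma limit_cdf_cvg s : Gn n s @[n --> \oo] --> limit_cdf s.
Proof.
apply: nonincreasing_is_cvgn; first exact: partial_cdf_nonincreasing.
by exists 0 => _ [n _ <-]; have /andP[] := partial_cdf01 n s.
Qed.

(** If both tilted values exceeded the right-hand side, some [y] would lie strictly between;
    convergence carries this strict separation to a finite [n], contradicting log-concavity of
    [Gn n]. *)
Lemma limit_cdf_log_concave : log_concave limit_cdf.
Proof.
move=> al be u v l l01; rewrite ge_min.
set c := expR (l * al + _).
have [h|h] := leP (expR al * limit_cdf u) (c * limit_cdf (l * u + (1 - l) * v)) => //=.
rewrite leNgt; apply/negP => h'.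
have cM (r x : R) : r * Gn n x @[n --> \oo] --> r * limit_cdf x.
  by apply: cvgM; [exact: cvg_cst|exact: limit_cdf_cvg].
have [y my yu] : exists2 y, c * limit_cdf (l * u + (1 - l) * v) < y &
    y < minr (expR al * limit_cdf u) (expR be * limit_cdf v).
  set p := c * _ in h h' *; set q := minr _ _.
  have pq : p < q by rewrite lt_min h h'.
  by exists ((p + q) / 2); lra.
move: yu; rewrite lt_min => /andP[yu yv].
have [n] : exists n, [/\ c * Gn n (l * u + (1 - l) * v) < y,
   y < expR al * Gn n u & y < expR be * Gn n v].
  have : \forall n \near \oo, [/\ c * Gn n (l * u + (1 - l) * v) < y,
     y < expR al * Gn n u & y < expR be * Gn n v].
    near=> n; split; near: n.
    - by have /cvgr_lt := cM c (l * u + (1 - l) * v); apply.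
    - by have /cvgr_gt := cM (expR al) u; apply.
    - by have /cvgr_gt := cM (expR be) v; apply.
  by move=> [n _ /(_ n (leqnn n))]; exists n.
move=> [nm nu nv].
have := partial_cdf_log_concave n al be u v l l01.
by rewrite -/c leNgt => /negP; apply; apply: lt_trans nm _; rewrite lt_min nu nv.
Unshelve. all: by end_near. Qed.

Lemma limit_cdf_slope (de K : R) : 0 < de -> de <= 2^-1 -> 0 <= K ->
  exists2 T : R, 0 < T & forall theta, T <= theta ->
  (forall p q, mu a theta - K / theta <= p -> p <= q ->
     limit_cdf q <= limit_cdf p * expR ((1 + de) * theta * (q - p))) /\
  (forall p q, p <= q -> q <= mu a theta + K / theta ->
     limit_cdf p * expR ((1 - de) * theta * (q - p)) <= limit_cdf q) /\
  (exists t t', [/\ t <= t', t' <= mu a theta - K / theta & 0 < limit_cdf t]).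
Proof.
have GnS n s := partial_cdf_recursion P a X n s iidX.
apply: slope_near_mu => //.
- by apply: (limit_homo Gn) => //; [exact: partial_cdf_homo|exact: limit_cdf_cvg].
- move=> s; have /andP[] // := limit01 Gn limit_cdf partial_cdf01 limit_cdf_cvg s.
- exact: limit_cdf_log_concave.
- move=> theta t0.
  have [N -> _] := laplace_limit a Gn limit_cdf a0 partial_cdf0 partial_cdf_homo
    partial_cdf01 partial_cdf_nonpos GnS limit_cdf_cvg theta t0.
  by [].
- exact: (laplace_limit_gt0 a Gn limit_cdf a0 cvg_a partial_cdf0 partial_cdf_homo
    partial_cdf01 partial_cdf_nonpos GnS limit_cdf_cvg).
- exact: (laplace_limit_shift a Gn limit_cdf a0 cvg_a partial_cdf0 partial_cdf_homo
    partial_cdf01 partial_cdf_nonpos GnS limit_cdf_cvg).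
Qed.

Lemma cdf_strict_le_limit s : cdf_strict P a X s <= limit_cdf s.
Proof.
apply: (cvgr_to_ge (limit_cdf_cvg s)); near=> n.
have mn := measurable_partial_zsum_lt n s; have mz := measurable_zsum_lt s.
rewrite /Gn /partial_cdf /cdf_strict fine_le ?fin_num_measure//.
rewrite le_measure ?inE// => w /=.
by move=> /(le_lt_trans (partial_zsum_le n w)); rewrite lte_fin.
Unshelve. all: by end_near. Qed.

(** By continuity from above the limit is the probability that all partial sums are below [s], where
    the full sum is at most [s < t]. *)
Lemma limit_cdf_le_strict s t : s < t -> limit_cdf s <= cdf_strict P a X t.
Proof.
move=> st; pose E n := [set w | S n w < s].
have mE n : measurable (E n) := measurable_partial_zsum_lt n s.
have mC : measurable (\bigcap_n E n) by apply: bigcapT_measurable.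
have cE : P (E n) @[n --> \oo] --> P (\bigcap_n E n).
  apply: nonincreasing_cvg_mu => //.
    by rewrite ltey_eq fin_num_measure.
  move=> m n mn; apply/subsetPset => w; rewrite /E/=.
  by apply: le_lt_trans; exact: partial_zsum_homo.
have : limit_cdf s <= fine (P (\bigcap_n E n)).
  have /fine_cvg : P (E n) @[n --> \oo] --> (fine (P (\bigcap_n E n)))%:E.
    by rewrite fineK// fin_num_measure.
  by move=> h; rewrite (cvg_unique _ (limit_cdf_cvg s) h).
move=> /le_trans; apply.
have mz := measurable_zsum_lt t.
rewrite /cdf_strict fine_le ?fin_num_measure// le_measure ?inE// => w Ew /=.
apply: (@le_lt_trans _ _ s%:E); last by rewrite lte_fin.
by apply: zsum_le => n; apply/ltW/(Ew n).
Qed.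

Lemma limit_cdf01 s : 0 <= limit_cdf s <= 1.
Proof. exact: (limit01 Gn _ partial_cdf01 limit_cdf_cvg). Qed.

Lemma limit_cdf_homo : {homo limit_cdf : x y / x <= y}.
Proof. exact: (limit_homo Gn _ partial_cdf_homo limit_cdf_cvg). Qed.

Lemma limit_cdf_nonpos s : s <= 0 -> limit_cdf s = 0.
Proof. exact: (limit_nonpos Gn _ partial_cdf_nonpos limit_cdf_cvg). Qed.

(* The monotone limit only sandwiches the distribution function up to atoms of z;
   log-concavity makes it continuous. *)
Lemma cdf_strictE : cdf_strict P a X = limit_cdf.
Proof.
apply/funext => s; apply/eqP; rewrite eq_le cdf_strict_le_limit/=.
have [s0|s0] := leP s 0.
  by rewrite limit_cdf_nonpos// /cdf_strict fine_ge0.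
apply: (limit_le_of_left a limit_cdf a0 cvg_a limit_cdf01 limit_cdf_slope) => // t ts.
exact: limit_cdf_le_strict.
Qed.

End partial_cdf_properties.

Theorem theorem2 (R : realType) (d : measure_display) (T : measurableType d)
  (P : probability T R) (X : nat -> T -> R) (a : nat -> R) :
  iid_std_normal P X ->
  (forall i, 0 < a i) ->
  {homo a : i j / (i <= j)%N >-> i <= j} ->
  cvgn (series (fun i => ((a i) ^+ 2)^-1)) ->
  Gamma0 (cdf_strict P a X) /\ aux_function (cdf_strict P a X) (rho_aux a).
Proof.
move=> iidX a0 nda cvg_a; rewrite cdf_strictE//.
set G := limit_cdf P X a.
have G01 := limit_cdf01 P X a iidX; have ndG := limit_cdf_homo P X a iidX.
have slopeG := limit_cdf_slope P X a iidX a0 nda cvg_a.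
have m1 := mu_gt0 a a0 cvg_a 1 ltr01.
have itvW : {subset `[0, mu a 1[ <= `[0, mu a 1]}.
  by move=> s; rewrite !in_itv/= => /andP[-> /ltW].
have rho0 : rho_aux a 0 = 0 by rewrite /rho_aux ltxx.
have monorho := rho_aux_mono a a0 cvg_a.
have auxG : aux_function G (rho_aux a).
  (* Up to [mu a 1] the inverse is genuine and at least 1, so [mu a 1] bounds a suitable
     right-neighbourhood of 0. *)
  exists (mu a 1); split => //; split.
    apply: continuous_subspaceW (rho_aux_continuous a a0 cvg_a).
    by move=> s /=; exact: itvW.
  split; first by move=> u v /itvW u1 /itvW v1; rewrite monorho.
  split.
    move=> s /itvW s1; rewrite -rho0 monorho//; last by rewrite in_itv/= lexx ltW.
    by move: s1; rewrite in_itv/= => /andP[].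
  split => // x.
  exact: limit_ratio.
split => //; split; first by move=> s; have /andP[] := G01 s.
split; first exact: (limit_cdf_nonpos P X a iidX).
split => //; split; last by exists (rho_aux a).
move=> s; apply: (limit_right_continuous a) => //.
exact: (limit_cdf_nonpos P X a iidX).
Qed.
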